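(* Let $\mathbf{R}$ be a category with finite colimits and let $p:\mathrm{Morph}(\mathbf{R})\to\mathbb{Z}$ be a categorical persistence function. If $F_1, F_2$ are two tame $(\mathbb{R},\le)$-indexed diagrams in $\mathbf{R}$, then $$d_{\mathbf{R}}(F_1,F_2)\ \ge\ d(\mathcal{D}F_1,\mathcal{D}F_2),$$ where $d_{\mathbf{R}}$ is the interleaving distance and $d(\mathcal{D}F_1,\mathcal{D}F_2)$ is the bottleneck distance between the persistence diagrams.
   Context: Categorical persistence function: for a category $\mathbf{C}$, a lower-bounded function $p:\mathrm{Morph}(\mathbf{C})\to\mathbb{Z}$ such that for all composable morphisms $u_1\to u_2\to v_1\to v_2$ (where $p(u_i\to v_j)$ is the value at the corresponding composite): (1) $p(u_1\to v_1)\le p(u_2\to v_1)$ and $p(u_2\to v_2)\le p(u_2\to v_1)$; (2) $p(u_2\to v_1)-p(u_1\to v_1)\ge p(u_2\to v_2)-p(u_1\to v_2)$. An $(\mathbb{R},\le)$-indexed diagram in $\mathbf{C}$ is a functor $F:(\mathbb{R},\le)\to\mathbf{C}$, where $(\mathbb{R},\le)$ is the poset category of the reals. Put $p_F(u,v)=p(F(u\le v))$ for real $u\le v$. Tameness: $F$ is constant on an interval $I\subset\mathbb{R}$ if $p_F(a,a)=p_F(a,b)=p_F(b,b)$ for all $a\le b$ in $I$. A point $a\in\mathbb{R}$ is a regular value if $F$ is constant on some connected neighborhood of $a$, and a critical value otherwise. $F$ is tame if it has finitely many critical values. Multiplicity: for $u<v$ in $\mathbb{R}\cup\{-\infty,+\infty\}$,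 the multiplicity $\mu(u,v)$ is the minimum, over disjoint connected neighborhoods $I_u,I_v$ of $u$ and $v$, of $$p_F(\sup I_u,\inf I_v)-p_F(\inf I_u,\inf I_v)-p_F(\sup I_u,\sup I_v)+p_F(\inf I_u,\sup I_v),$$ with the convention that $p_F(u,v)=\min_{x\le y\in\mathbb{R}}p_F(x,y)$ whenever $u$ or $v$ is not finite. If $\mu(u,v)>0$, $(u,v)$ is a cornerpoint. The persistence diagram $\mathcal{D}F$ is the multiset of the cornerpoints (with multiplicity $\mu$), along with all diagonal points $(u,u)$, $u\in\mathbb{R}$, each with countably infinite multiplicity. Bottleneck distance: $d(\mathcal{D}F,\mathcal{D}G)=\inf_{\beta}\sup_{q\in\mathcal{D}F}\|q-\beta(q)\|_\infty$, where $\beta$ ranges over all bijections of multisets $\mathcal{D}F\to\mathcal{D}G$ (equal infinite coordinates are at distance $0$, a finite and an infinite coordinate, or two different infinite ones, at distance $\infty$). Interleaving distance: let $T_b:(\mathbb{R},\le)\to(\mathbb{R},\le)$, $T_b(a)=a+b$, and for $b\ge 0$ let $\eta_b:\mathrm{Id}\to T_b$ be the natural transformation $a\le a+b$. For $\epsilon\ge0$, $F,G:(\mathbb{R},\le)\to\mathbf{C}$ are $\epsilon$-interleaved if there are natural transformations $\phi^F:F\to GT_\epsilon$, $\phi^G:G\to FT_\epsilon$ with $(\phi^GT_\epsilon)\phi^F=F\eta_{2\epsilon}$ and $(\phi^FT_\epsilon)\phi^G=G\eta_{2\epsilon}$. The interleaving distance $d_{\mathbf{C}}(F,G)$ is the infimum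 of all $\epsilon$ such that $F,G$ are $\epsilon$-interleaved ($\infty$ if there are none). *)

(* Defs.v *)
From HB Require Import structures.
From mathcomp Require Import all_boot all_order all_algebra.
From mathcomp Require Import all_classical all_reals all_analysis.

Set Implicit Arguments.
Unset Strict Implicit.
Unset Printing Implicit Defensive.
Import Order.TTheory GRing.Theory Num.Theory.
Import numFieldNormedType.Exports.
Local Open Scope classical_set_scope.
Local Open Scope ring_scope.

Record category := Category {
  ob :> Type;
  mor : ob -> ob -> Type;
  idm : forall a, mor a a;
  mcomp : forall a b c, mor b c -> mor a b -> mor a c;
  comp1m : forall a b (f : mor a b), mcomp (idm b) f = f;
  compm1 : forall a b (f : mor a b), mcomp f (idm a) = f;
  compmA : forall a b c d (h : mor c d) (g : mor b c) (f : mor a b),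
    mcomp h (mcomp g f) = mcomp (mcomp h g) f }.

Record functor (C D : category) := Functor {
  fob :> C -> D;
  fmor : forall a b : C, mor a b -> mor (fob a) (fob b);
  fmap1 : forall a : C, fmor (idm a) = idm (fob a);
  fmapM : forall (a b c : C) (g : mor b c) (f : mor a b),
    fmor (mcomp g f) = mcomp (fmor g) (fmor f) }.

Definition idF (C : category) : functor C C :=
  @Functor C C id (fun _ _ f => f) (fun _ => erefl) (fun _ _ _ _ _ => erefl).

Section CompF.
Variables (C D E : category) (G : functor D E) (F : functor C D).

Fact compF1 (a : C) : fmor G (fmor F (idm a)) = idm (G (F a)).
Proof. by rewrite !fmap1. Qed.

Fact compFM (a b c : C) (g : mor b c) (f : mor a b) :
  fmor G (fmor F (mcomp g f)) = mcomp (fmor G (fmor F g)) (fmor G (fmor F f)).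
Proof. by rewrite !fmapM. Qed.

Definition compF : functor C E :=
  @Functor C E (fun a => G (F a)) (fun a b f => fmor G (fmor F f)) compF1 compFM.

End CompF.

Record nat_trans (C D : category) (F G : functor C D) := NatTrans {
  component :> forall a : C, mor (F a) (G a);
  naturality : forall (a b : C) (f : mor a b),
    mcomp (component b) (fmor F f) = mcomp (fmor G f) (component a) }.

Record cocone (J C : category) (D : functor J C) := Cocone {
  apex : C;
  leg : forall j : J, mor (D j) apex;
  leg_nat : forall (i j : J) (u : mor i j), mcomp (leg j) (fmor D u) = leg i }.

Definition is_colimit (J C : category) (D : functor J C) (c : cocone D) : Prop :=
  forall d : cocone D, exists! f : mor (apex c) (apex d),
    forall j : J, mcomp f (leg c j) = leg d j.

Definition finite_category (J : category) : Prop :=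
  finite_set [set: ob J] /\ forall i j : J, finite_set [set: mor i j].

Definition has_finite_colimits (C : category) : Prop :=
  forall J : category, finite_category J ->
  forall D : functor J C, exists c : cocone D, is_colimit c.

Definition persistence_function (C : category)
    (p : forall a b : C, mor a b -> int) : Prop :=
  [/\ exists m : int, forall (a b : C) (f : mor a b), m <= p a b f,
      forall (u1 u2 v1 : C) (f : mor u1 u2) (g : mor u2 v1),
        p u1 v1 (mcomp g f) <= p u2 v1 g,
      forall (u2 v1 v2 : C) (g : mor u2 v1) (h : mor v1 v2),
        p u2 v2 (mcomp h g) <= p u2 v1 g
    & forall (u1 u2 v1 v2 : C) (f : mor u1 u2) (g : mor u2 v1) (h : mor v1 v2),
        p u2 v1 g - p u1 v1 (mcomp g f) >=
        p u2 v2 (mcomp h g) - p u1 v2 (mcomp h (mcomp g f))].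

Section RealIndexed.
Variable R : realType.

Definition real_poset : category :=
  @Category R (fun x y : R => (x <= y)%R)
    (fun x => lexx x)
    (fun x y z (hyz : y <= z) (hxy : x <= y) => le_trans hxy hyz)
    (fun _ _ _ => bool_irrelevance _ _)
    (fun _ _ _ => bool_irrelevance _ _)
    (fun _ _ _ _ _ _ _ => bool_irrelevance _ _).

Fact shift_le (b x y : R) : x <= y -> x + b <= y + b.
Proof. by rewrite lerD2r. Qed.

Definition translation (b : R) : functor real_poset real_poset :=
  @Functor real_poset real_poset (fun x : R => x + b) (@shift_le b)
    (fun _ => bool_irrelevance _ _) (fun _ _ _ _ _ => bool_irrelevance _ _).

Fact eta2_le (e : R) (e0 : 0 <= e) (x : R) : x <= x + e + e.
Proof. by rewrite -addrA lerDl addr_ge0. Qed.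

(* [translation e \o translation e] and [translation (e + e)] agree only up to the propositional
   equality [x + e + e = x + (e + e)]; the transformation from the identity to
   [translation (e + e)] is therefore given with target [translation e \o translation e]. *)
Definition eta2 (e : R) (e0 : 0 <= e) :
    nat_trans (idF real_poset) (compF (translation e) (translation e)) :=
  @NatTrans real_poset real_poset (idF real_poset) (compF (translation e) (translation e))
    (@eta2_le e e0) (fun _ _ _ => bool_irrelevance _ _).

Section Diagrams.
Variable C : category.
Implicit Types F G : functor real_poset C.

Definition interleaved (e : R) F G : Prop :=
  exists (e0 : 0 <= e)
         (phiF : nat_trans F (compF G (translation e)))
         (phiG : nat_trans G (compF F (translation e))),
    (forall a : real_poset,
       mcomp (phiG (translation e a)) (phiF a) = fmor F (eta2 e0 a)) /\
    (forall a : real_poset,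
       mcomp (phiF (translation e a)) (phiG a) = fmor G (eta2 e0 a)).

Definition interleaving_dist F G : \bar R :=
  ereal_inf [set e%:E | e in [set e : R | interleaved e F G]].

Variable p : forall a b : C, mor a b -> int.

Definition pdiag F (u v : R) (uv : u <= v) : int :=
  p (@fmor real_poset C F u v uv).

Definition constant_on F (I : set R) : Prop :=
  forall (a b : R) (ab : a <= b), I a -> I b ->
    pdiag F (lexx a) = pdiag F ab /\ pdiag F ab = pdiag F (lexx b).

Definition regular_value F (a : R) : Prop :=
  exists I : set R, [/\ nbhs a I, connected I & constant_on F I].

Definition critical_value F (a : R) : Prop := ~ regular_value F a.

Definition tame F : Prop := finite_set [set a : R | critical_value F a].

(* The least element of [A]; 0 if there is none. *)
Definition min_of (A : set int) : int := xget 0 (A `&` lbound A).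

Definition pdiag_min F : int :=
  min_of [set n | exists (x y : R) (xy : x <= y), n = pdiag F xy].

(* The value at finite [u > v] is junk: [u <= v] at all uses below. *)
Definition pdiag_ext F (u v : \bar R) : int :=
  match u, v with
  | x%:E, y%:E => if @idP (x <= y) is ReflectT xy then pdiag F xy else 0
  | _, _ => pdiag_min F
  end.

Definition multiplicity F (u v : \bar R) : int :=
  min_of [set n | exists Iu Iv : set (\bar R),
    [/\ nbhs u Iu /\ connected Iu, nbhs v Iv /\ connected Iv,
        Iu `&` Iv = set0
      & n = pdiag_ext F (ereal_sup Iu) (ereal_inf Iv)
            - pdiag_ext F (ereal_inf Iu) (ereal_inf Iv)
            - pdiag_ext F (ereal_sup Iu) (ereal_sup Iv)
            + pdiag_ext F (ereal_inf Iu) (ereal_sup Iv)]].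

Definition cornerpoint F (q : \bar R * \bar R) : Prop :=
  (q.1 < q.2)%E /\ 0 < multiplicity F q.1 q.2.

(* A multiset of points is represented by its set of labelled copies
   [(point, label)], so that a point of multiplicity [m] carries the labels
   [0, ..., m - 1] and a point of countably infinite multiplicity carries all
   natural numbers; bijections of multisets are bijections of these sets. *)
Definition persistence_diagram F : set ((\bar R * \bar R) * nat) :=
  [set qk | cornerpoint F qk.1 /\ (qk.2%:Z < multiplicity F qk.1.1 qk.1.2)]
  `|` [set qk | exists x : R, qk.1 = (x%:E, x%:E)].

End Diagrams.

(* The test [x == y] is needed since [+oo - +oo = -oo] in [\bar R]. *)
Definition coord_dist (x y : \bar R) : \bar R :=
  if x == y then 0%E else `|x - y|%E.

Definition point_dist (q r : \bar R * \bar R) : \bar R :=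
  maxe (coord_dist q.1 r.1) (coord_dist q.2 r.2).

Definition bottleneck_dist (A B : set ((\bar R * \bar R) * nat)) : \bar R :=
  ereal_inf [set c | exists2 beta, set_bij A B beta &
    c = ereal_sup [set point_dist q.1 (beta q).1 | q in A]].

End RealIndexed.

(* Main.v *)
Require Import Defs.
From mathcomp Require Import all_boot all_order all_algebra.
From mathcomp Require Import all_classical all_reals all_analysis.
From mathcomp Require Import zify ring lra.

(* Interpolate an interleaving of F and G: for (a, b) in the plane let W(a, b) be the colimit
   of all F(x), x <= a, and G(y), y <= b, along the structure and interleaving maps (four
   objects suffice). Then W is a functor on the plane with W(a, a - d) = F(a) and
   W(b - d, b) = G(b). Fix a step s with d = E s. The diagonal chains
   z_c(i) = (g + s i, g + s i - d + c s), 0 <= c <= 2E, lead from samples of F to samples of G,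
   and z_c and z_{c+1} are both subchains of a staircase. Passing to a subchain rounds
   the coordinates of the points of the persistence diagram up to the subchain, so the diagrams
   of the staircase match those of z_c and z_{c+1} with total index shift at most 1. Composing
   the 2E matchings gives a matching of the sampled diagrams of cost at most d, and for a grid
   separating the critical values the diagrams of tame F and G are the sampled ones
   up to an error s. *)

Set Implicit Arguments.
Unset Strict Implicit.
Unset Printing Implicit Defensive.
Import Order.TTheory GRing.Theory Num.Theory.
Import numFieldNormedType.Exports.
Local Open Scope classical_set_scope.
Local Open Scope ring_scope.

(** * Interpolation *)

(** A persistence function yields integers only, so there are no interval decompositions to match.
    The third axiom replaces them: it makes the second differences of a rank nonnegative, so along a
    finite chain the rank counts the points of a finite multiset. Comparing chains this way needs
    both inside one functor to which [p] applies; this is why the interleaving is filled in, and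
    where finite colimits enter. Three difficulties shape the rest. Rounding can merge the two
    coordinates of a point, so lists may contain diagonal points, which no rank counts and which a
    composition of matchings has to carry along. Chains are finite while diagrams have infinite
    coordinates, so both ends get sentinels, and critical values stay [3 * E] cells away from the
    ends: a drift of at most [2 * E] then never exchanges finite and infinite coordinates. Finally,
    [d] is taken slightly above the interleaving parameter, hence positive even at parameter zero,
    so that it can be cut into [E > 0] equal steps of arbitrarily small size [s]. *)

Definition rank_function (T : Type) (le : rel T) (r : T -> T -> int) : Prop :=
  [/\ forall a b c, le a b -> le b c -> r a c <= r b c,
      forall a b c, le a b -> le b c -> r a c <= r a b
    & forall a b c d, le a b -> le b c -> le c d -> r b d - r a d <= r b c - r a c].

Section RankOfDiagram.
Variables (C : category) (p : forall a b : C, mor a b -> int).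
Hypothesis hp : persistence_function p.
Variables (T : Type) (le : rel T) (W : T -> C).
Variable Wmap : forall x y, le x y -> mor (W x) (W y).

(* Junk value [0] unless [le x y]. *)
Definition diagram_rank (x y : T) : int :=
  if @idP (le x y) is ReflectT xy then p (Wmap xy) else 0.

Lemma diagram_rankE (x y : T) (xy : le x y) : diagram_rank x y = p (Wmap xy).
Proof.
rewrite /diagram_rank; case: {-}_ / idP => [xy'|//].
by rewrite (bool_irrelevance xy xy').
Qed.

Hypothesis le_trans : forall x y z, le x y -> le y z -> le x z.
Hypothesis WmapM : forall x y z (xz : le x z) (yz : le y z) (xy : le x y),
  mcomp (Wmap yz) (Wmap xy) = Wmap xz.

Lemma diagram_rankP : rank_function le diagram_rank.
Proof.
have [_ p1 p2 p3] := hp; split.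
- move=> a b c ab bc; rewrite (diagram_rankE bc) (diagram_rankE (le_trans ab bc)).
  by rewrite -(WmapM _ bc ab); exact: p1.
- move=> a b c ab bc; rewrite (diagram_rankE ab) (diagram_rankE (le_trans ab bc)).
  by rewrite -(WmapM _ bc ab); exact: p2.
- move=> a b c d ab bc cd.
  have bd := le_trans bc cd; have ac := le_trans ab bc; have ad := le_trans ac cd.
  rewrite (diagram_rankE bc) (diagram_rankE bd) (diagram_rankE ac) (diagram_rankE ad).
  rewrite -(WmapM bd cd bc) -(WmapM ad bd ab) -(WmapM bd cd bc) -(WmapM ac bc ab) -compmA.
  exact: p3.
Qed.

End RankOfDiagram.

(** The first boolean is the level, the second the side: two minimal elements, each below both
    maximal ones. A cocone on this shape is a pair of maps out of the maximal objects that agree on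
    both minimal ones. *)
Definition k22_le (i j : bool * bool) : bool := (i == j) || (~~ i.1 && j.1).

Fact k22_le_trans (i j k : bool * bool) : k22_le j k -> k22_le i j -> k22_le i k.
Proof. by case: i j k => [[] []] [[] []] [[] []]. Qed.

Definition k22 : category :=
  @Category (bool * bool)%type (fun i j => is_true (k22_le i j))
    (fun i => introT orP (or_introl (eqxx i)))
    k22_le_trans
    (fun _ _ _ => bool_irrelevance _ _)
    (fun _ _ _ => bool_irrelevance _ _)
    (fun _ _ _ _ _ _ _ => bool_irrelevance _ _).

Lemma k22_finite : finite_category k22.
Proof.
split; first exact: (@finite_finset (bool * bool)%type setT).
move=> i j; case: (boolP (k22_le i j)) => hij.
- by apply: (@sub_finite_set _ _ [set hij]) => // h _; exact: bool_irrelevance.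
- apply: (@sub_finite_set _ _ set0) => // h _.
  by move: hij; rewrite (h : is_true (k22_le i j)).
Qed.

Section K22Diagram.
Variables (C : category) (A B X Y : C).
Variables (aX : mor A X) (aY : mor A Y) (bX : mor B X) (bY : mor B Y).

Definition k22_ob (i : bool * bool) : C :=
  match i with
  | (false, false) => A | (false, true) => B
  | (true, false) => X | (true, true) => Y
  end.

Definition k22_map (i j : bool * bool) : k22_le i j -> mor (k22_ob i) (k22_ob j) :=
  match i, j with
  | (false, false), (false, false) => fun=> idm A
  | (false, true), (false, true) => fun=> idm B
  | (true, false), (true, false) => fun=> idm X
  | (true, true), (true, true) => fun=> idm Y
  | (false, false), (true, false) => fun=> aX
  | (false, false), (true, true) => fun=> aY
  | (false, true), (true, false) => fun=> bX
  | (false, true), (true, true) => fun=> bY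
  | _, _ => fun h => False_rect _ (notF h)
  end.

Fact k22_map1 (i : k22) : k22_map (idm i) = idm (k22_ob i).
Proof. by case: i => [[] []]. Qed.

Fact k22_mapM (i j k : k22) (g : mor j k) (f : mor i j) :
  k22_map (mcomp g f) = mcomp (k22_map g) (k22_map f).
Proof.
case: i j k f g => [[] []] [[] []] [[] []] //= f g;
  by rewrite ?comp1m ?compm1.
Qed.

Definition k22_functor : functor k22 C := @Functor k22 C k22_ob k22_map k22_map1 k22_mapM.

Lemma k22_colimit : has_finite_colimits C ->
  exists (Z : C) (x : mor X Z) (y : mor Y Z),
    [/\ mcomp x aX = mcomp y aY, mcomp x bX = mcomp y bY &
      forall (Z' : C) (x' : mor X Z') (y' : mor Y Z'),
        mcomp x' aX = mcomp y' aY -> mcomp x' bX = mcomp y' bY ->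
        exists! h : mor Z Z', mcomp h x = x' /\ mcomp h y = y'].
Proof.
move=> hC; have [c cP] := hC k22 k22_finite k22_functor.
exists (apex c), (leg c (true, false)), (leg c (true, true)); split.
- have -> := @leg_nat _ _ _ c (false, false) (true, false) erefl.
  by have -> := @leg_nat _ _ _ c (false, false) (true, true) erefl.
- have -> := @leg_nat _ _ _ c (false, true) (true, false) erefl.
  by have -> := @leg_nat _ _ _ c (false, true) (true, true) erefl.
move=> Z' x' y' exa exb.
pose l (i : k22) : mor (k22_functor i) Z' :=
  match i with
  | (false, false) => mcomp x' aX | (false, true) => mcomp x' bX
  | (true, false) => x' | (true, true) => y'
  end.
have lP (i j : k22) (u : mor i j) : mcomp (l j) (fmor k22_functor u) = l i.
  by case: i j u => [[] []] [[] []] //= u; rewrite ?compm1.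
have [h [hl hu]] := cP (Cocone lP).
exists h; split; first by split; [exact: (hl (true, false)) | exact: (hl (true, true))].
move=> h' [h'x h'y]; apply: hu => -[[] []] //=.
- by have <- := @leg_nat _ _ _ c (false, true) (true, false) erefl; rewrite compmA h'x.
- by have <- := @leg_nat _ _ _ c (false, false) (true, false) erefl; rewrite compmA h'x.
Qed.

End K22Diagram.

(** * The functor on the plane built from an interleaving *)

Section Interpolation.
Variables (R : realType) (C : category) (F G : functor (real_poset R) C).
Variables (e d : R) (e0 : 0 <= e) (ed : e <= d).
Variables (phi : nat_trans F (compF G (translation e)))
  (psi : nat_trans G (compF F (translation e))).
Hypothesis psiphi : forall a : real_poset R,
  mcomp (psi (translation e a)) (phi a) = fmor F (eta2 e0 a).
Hypothesis phipsi : forall a : real_poset R,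
  mcomp (phi (translation e a)) (psi a) = fmor G (eta2 e0 a).

Local Notation node := (R * bool)%type.

(** Two copies of the real line, with [F] on [false] and [G] on [true], where changing copy costs
    [d]. An interleaving with parameter [d] amounts to one functor on this preorder restricting to
    [F] and [G]. *)
Definition zz_le (z w : node) : bool := z.1 + (if z.2 == w.2 then 0 else d) <= w.1.

Fact zz_le_trans (z w v : node) : zz_le z w -> zz_le w v -> zz_le z v.
Proof.
have d0 : 0 <= d by exact: le_trans ed.
by case: z w v => [x []] [y []] [t []]; rewrite /zz_le /=; lra.
Qed.

Definition zz_ob (z : node) : C := if z.2 then G z.1 else F z.1.

Fact zz_same (x y : R) : x + 0 <= y -> x <= y. Proof. by rewrite addr0. Qed.
Fact zz_diff (x y : R) : x + d <= y -> x + e <= y.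
Proof. by apply: le_trans; rewrite lerD2l. Qed.

Definition zz_map (z w : node) : zz_le z w -> mor (zz_ob z) (zz_ob w) :=
  match z, w with
  | (x, false), (y, false) => fun h => @fmor _ _ F x y (zz_same h)
  | (x, true), (y, true) => fun h => @fmor _ _ G x y (zz_same h)
  | (x, false), (y, true) => fun h => mcomp (@fmor _ _ G (x + e) y (zz_diff h)) (phi x)
  | (x, true), (y, false) => fun h => mcomp (@fmor _ _ F (x + e) y (zz_diff h)) (psi x)
  end.

Lemma fmor_irr (H : functor (real_poset R) C) (x y : R) (h k : x <= y) :
  @fmor _ _ H x y h = @fmor _ _ H x y k.
Proof. by congr fmor; exact: bool_irrelevance. Qed.

Lemma fmor_trans (H : functor (real_poset R) C) (x y z : R) (h : y <= z) (k : x <= y)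
    (l : x <= z) :
  mcomp (@fmor _ _ H y z h) (@fmor _ _ H x y k) = @fmor _ _ H x z l.
Proof. by rewrite -fmapM; exact: fmor_irr. Qed.

(** Only chains that change copy twice use the interleaving identities; the other cases are
    functoriality or naturality. *)
Lemma zz_mapM (z w v : node) (h : zz_le z v) (k : zz_le w v) (l : zz_le z w) :
  mcomp (zz_map k) (zz_map l) = zz_map h.
Proof.
have shift (H H' : functor (real_poset R) C) (f : nat_trans H (compF H' (translation e)))
    (x y t : R) (yt : y + e <= t) (xy : x <= y) (xt : x + e <= t) :
  mcomp (mcomp (@fmor _ _ H' (y + e) t yt) (f y)) (@fmor _ _ H x y xy) =
  mcomp (@fmor _ _ H' (x + e) t xt) (f x).
  have /= n := @naturality _ _ _ _ f x y xy.
  by rewrite -compmA n compmA; congr mcomp; exact: fmor_trans.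
case: z w v h k l => [x i] [y j] [t m].
case: i j m => [] [] [] h k l /=; first [exact: fmor_trans | exact: shift | idtac].
- have xt : x + e + e <= t.
    by apply: le_trans (zz_diff k); rewrite lerD2r; exact: zz_diff l.
  rewrite compmA (shift _ _ phi (x + e) _ _ _ (zz_diff l) xt) -compmA.
  by rewrite (phipsi x); exact: fmor_trans.
- by rewrite compmA; congr mcomp; exact: fmor_trans.
- by rewrite compmA; congr mcomp; exact: fmor_trans.
- have xt : x + e + e <= t.
    by apply: le_trans (zz_diff k); rewrite lerD2r; exact: zz_diff l.
  rewrite compmA (shift _ _ psi (x + e) _ _ _ (zz_diff l) xt) -compmA.
  by rewrite (psiphi x); exact: fmor_trans.
Qed.

Fact zz_le_refl (z : node) : zz_le z z.
Proof. by rewrite /zz_le eqxx addr0. Qed.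

Lemma zz_map1 (z : node) (h : zz_le z z) : zz_map h = idm (zz_ob z).
Proof.
case: z h => [x []] h /=; rewrite -[RHS]fmap1; congr fmor; exact: bool_irrelevance.
Qed.

Definition compatible (a b : R) (Z : C) (x : mor (F a) Z) (y : mor (G b) Z) : Prop :=
  forall (w : node) (h : zz_le w (a, false)) (k : zz_le w (b, true)),
    mcomp x (zz_map h) = mcomp y (zz_map k).

(** The colimit over all nodes below [(a, false)] or [(b, true)], given by its legs at these two
    nodes: every other leg factors through one of them, and [compatible] makes the choice
    immaterial. *)
Record amalgam (a b : R) := Amalgam {
  amal_ob : C;
  amal_inl : mor (F a) amal_ob;
  amal_inr : mor (G b) amal_ob;
  amal_compat : compatible amal_inl amal_inr;
  amal_univ : forall (Z : C) (x : mor (F a) Z) (y : mor (G b) Z), compatible x y ->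
    exists! h : mor amal_ob Z, mcomp h amal_inl = x /\ mcomp h amal_inr = y }.

(* The nodes below both [(a, false)] and [(b, true)] lie below one of the two nodes
   [(min a (b - d), false)] and [(min b (a - d), true)], so a colimit over four
   objects suffices. *)
Lemma amalgam_exists (a b : R) : has_finite_colimits C -> exists _ : amalgam a b, True.
Proof.
move=> hC.
pose m := Num.min a (b - d); pose n := Num.min b (a - d).
have ma : zz_le (m, false) (a, false) by rewrite /zz_le /= addr0 /m ge_min lexx.
have mb : zz_le (m, false) (b, true).
  by rewrite /zz_le /= -lerBrDr /m ge_min lexx orbT.
have nb : zz_le (n, true) (b, true) by rewrite /zz_le /= addr0 /n ge_min lexx.
have na : zz_le (n, true) (a, false).
  by rewrite /zz_le /= -lerBrDr /n ge_min lexx orbT.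
have [Z [x [y [xym xyn U]]]] :=
  k22_colimit (zz_map ma) (zz_map mb) (zz_map na) (zz_map nb) hC.
have cxy : compatible x y.
  move=> [t []] h k.
  - have tn : zz_le (t, true) (n, true).
      by move: h k; rewrite /zz_le /= !addr0 /n le_min lerBrDr => -> ->.
    by rewrite -(zz_mapM h na tn) -(zz_mapM k nb tn) (compmA x) (compmA y) xyn.
  - have tm : zz_le (t, false) (m, false).
      by move: h k; rewrite /zz_le /= !addr0 /m le_min lerBrDr => -> ->.
    by rewrite -(zz_mapM h ma tm) -(zz_mapM k mb tm) (compmA x) (compmA y) xym.
exists (Amalgam cxy (fun Z' x' y' c' => U Z' x' y' (c' _ ma mb) (c' _ na nb))).
exact: I.
Qed.

Hypothesis hC : has_finite_colimits C.

Definition amal (a b : R) : amalgam a b := projT1 (cid (amalgam_exists a b hC)).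

Definition grid_le (z w : R * R) : bool := (z.1 <= w.1) && (z.2 <= w.2).

Definition amal_at (z : R * R) : amalgam z.1 z.2 := amal z.1 z.2.

Lemma amal_map_exists (z w : R * R) : grid_le z w ->
  exists f : mor (amal_ob (amal_at z)) (amal_ob (amal_at w)),
  forall (h : zz_le (z.1, false) (w.1, false)) (k : zz_le (z.2, true) (w.2, true)),
    mcomp f (amal_inl (amal_at z)) = mcomp (amal_inl (amal_at w)) (zz_map h) /\
    mcomp f (amal_inr (amal_at z)) = mcomp (amal_inr (amal_at w)) (zz_map k).
Proof.
move=> /andP[zw1 zw2].
have h : zz_le (z.1, false) (w.1, false) by rewrite /zz_le /= addr0.
have k : zz_le (z.2, true) (w.2, true) by rewrite /zz_le /= addr0.
have c : compatible (mcomp (amal_inl (amal_at w)) (zz_map h))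
                    (mcomp (amal_inr (amal_at w)) (zz_map k)).
  move=> v h' k'; rewrite -!compmA.
  have -> := zz_mapM (zz_le_trans h' h) h h'; have -> := zz_mapM (zz_le_trans k' k) k k'.
  exact: amal_compat.
have [f [[f1 f2] _]] := amal_univ (amal_at z) c.
exists f => h' k'; rewrite f1 f2; split; congr mcomp.
- by rewrite (bool_irrelevance h h').
- by rewrite (bool_irrelevance k k').
Qed.

Definition amal_map (z w : R * R) (zw : grid_le z w) := projT1 (cid (amal_map_exists zw)).

Lemma amal_mapP (z w : R * R) (zw : grid_le z w)
    (h : zz_le (z.1, false) (w.1, false)) (k : zz_le (z.2, true) (w.2, true)) :
  mcomp (amal_map zw) (amal_inl (amal_at z)) = mcomp (amal_inl (amal_at w)) (zz_map h) /\
  mcomp (amal_map zw) (amal_inr (amal_at z)) = mcomp (amal_inr (amal_at w)) (zz_map k).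
Proof. exact: (projT2 (cid (amal_map_exists zw))). Qed.

Lemma amal_mapM (z w v : R * R) (h : grid_le z v) (k : grid_le w v) (l : grid_le z w) :
  mcomp (amal_map k) (amal_map l) = amal_map h.
Proof.
have [[h1 h2] [k1 k2] [l1 l2]] := And3 (andP h) (andP k) (andP l).
have H (t u : R) i (tu : t <= u) : zz_le (t, i) (u, i) by rewrite /zz_le eqxx addr0.
have [hl hr] := amal_mapP h (H _ _ _ h1) (H _ _ _ h2).
have [kl kr] := amal_mapP k (H _ _ _ k1) (H _ _ _ k2).
have [ll lr] := amal_mapP l (H _ _ _ l1) (H _ _ _ l2).
have c : compatible (mcomp (amal_map h) (amal_inl (amal_at z)))
    (mcomp (amal_map h) (amal_inr (amal_at z))).
  by move=> u h' k'; rewrite -!compmA; congr mcomp; exact: amal_compat.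
have [f [_ fu]] := amal_univ (amal_at z) c.
rewrite -(fu _ (conj erefl erefl)); apply/esym/fu; split.
- rewrite -compmA ll compmA kl hl -compmA; congr mcomp.
  exact (zz_mapM (H _ _ false h1) (H _ _ false k1) (H _ _ false l1)).
- rewrite -compmA lr compmA kr hr -compmA; congr mcomp.
  exact (zz_mapM (H _ _ true h2) (H _ _ true k2) (H _ _ true l2)).
Qed.

(** When [b = a - d], the node [(b, true)] lies below [(a, false)], which is then the greatest node
    of the colimit and carries its value. *)
Lemma amal_inl_iso (a b : R) : b = a - d ->
  exists r : mor (amal_ob (amal a b)) (F a),
    mcomp r (amal_inl (amal a b)) = idm _ /\ mcomp (amal_inl (amal a b)) r = idm _.
Proof.
move=> ba; have l : zz_le (b, true) (a, false) by rewrite /zz_le /= ba subrK.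
have c : compatible (idm (F a)) (zz_map l).
  by move=> w h k; rewrite comp1m; exact (esym (zz_mapM h l k)).
have [r [[r1 r2] _]] := amal_univ (amal a b) c.
exists r; split => //.
have [f [_ fu]] := amal_univ (amal a b) (@amal_compat _ _ (amal a b)).
rewrite -(fu (idm _)); last by rewrite !comp1m.
apply/esym/fu; split; first by rewrite -compmA r1 compm1.
rewrite -compmA r2; have := @amal_compat _ _ (amal a b) _ l (zz_le_refl (b, true)).
by rewrite zz_map1 compm1.
Qed.

Lemma amal_inr_iso (a b : R) : a = b - d ->
  exists r : mor (amal_ob (amal a b)) (G b),
    mcomp r (amal_inr (amal a b)) = idm _ /\ mcomp (amal_inr (amal a b)) r = idm _.
Proof.
move=> ab; have l : zz_le (a, false) (b, true) by rewrite /zz_le /= ab subrK.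
have c : compatible (zz_map l) (idm (G b)).
  by move=> w h k; rewrite comp1m; exact (zz_mapM k l h).
have [r [[r1 r2] _]] := amal_univ (amal a b) c.
exists r; split => //.
have [f [_ fu]] := amal_univ (amal a b) (@amal_compat _ _ (amal a b)).
rewrite -(fu (idm _)); last by rewrite !comp1m.
apply/esym/fu; split; last by rewrite -compmA r2 compm1.
rewrite -compmA r1; have := @amal_compat _ _ (amal a b) _ (zz_le_refl (a, false)) l.
by rewrite zz_map1 compm1 => ->.
Qed.

Variable p : forall a b : C, mor a b -> int.
Hypothesis hp : persistence_function p.

(** Applied in both directions along an isomorphism, this gives the invariance of [p], which thus
    follows from monotonicity in the two arguments. *)
Lemma persistence_conj (a b a' b' : C) (f : mor a b) (f' : mor a' b')
    (g : mor a a') (h : mor b' b) : mcomp h (mcomp f' g) = f -> p f <= p f'.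
Proof.
have [_ p1 p2 _] := hp; move=> <-.
by apply: le_trans (p2 _ _ _ _ _) _; exact: p1.
Qed.

Let grid_rank := diagram_rank p amal_map.

Lemma grid_rankP : rank_function grid_le grid_rank.
Proof.
apply: diagram_rankP => // [x y z|x y z xz yz xy]; last exact: amal_mapM.
by move=> /andP[xy1 xy2] /andP[yz1 yz2]; rewrite /grid_le (le_trans xy1) ?(le_trans xy2).
Qed.

Lemma grid_rank_inl (x y : R) (xy : x <= y) : grid_rank (x, x - d) (y, y - d) = pdiag p F xy.
Proof.
have zw : grid_le (x, x - d) (y, y - d) by rewrite /grid_le /= lerD2r xy.
rewrite /grid_rank (diagram_rankE _ _ zw) /pdiag.
have h : zz_le (x, false) (y, false) by rewrite /zz_le /= addr0.
have k : zz_le (x - d, true) (y - d, true) by rewrite /zz_le /= addr0 lerD2r.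
have [fl _] := @amal_mapP (x, x - d) (y, y - d) zw h k.
have [r [r1 r2]] := @amal_inl_iso x (x - d) erefl.
have [r' [r1' r2']] := @amal_inl_iso y (y - d) erefl.
rewrite /= (fmor_irr F (zz_same h) xy) in fl.
apply/eqP; rewrite eq_le; apply/andP; split.
- apply: (persistence_conj (g := r) (h := amal_inl (amal y (y - d)))).
  by rewrite compmA -fl -compmA r2 compm1.
- apply: (persistence_conj (g := amal_inl (amal x (x - d))) (h := r')).
  by rewrite fl compmA r1' comp1m.
Qed.

Lemma grid_rank_inr (x y : R) (xy : x <= y) : grid_rank (x - d, x) (y - d, y) = pdiag p G xy.
Proof.
have zw : grid_le (x - d, x) (y - d, y) by rewrite /grid_le /= lerD2r xy.
rewrite /grid_rank (diagram_rankE _ _ zw) /pdiag.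
have h : zz_le (x - d, false) (y - d, false) by rewrite /zz_le /= addr0 lerD2r.
have k : zz_le (x, true) (y, true) by rewrite /zz_le /= addr0.
have [_ fl] := @amal_mapP (x - d, x) (y - d, y) zw h k.
have [r [r1 r2]] := @amal_inr_iso (x - d) x erefl.
have [r' [r1' r2']] := @amal_inr_iso (y - d) y erefl.
rewrite /= (fmor_irr G (zz_same k) xy) in fl.
apply/eqP; rewrite eq_le; apply/andP; split.
- apply: (persistence_conj (g := r) (h := amal_inr (amal (y - d) y))).
  by rewrite compmA -fl -compmA r2 compm1.
- apply: (persistence_conj (g := amal_inr (amal (x - d) x)) (h := r')).
  by rewrite fl compmA r1' comp1m.
Qed.

End Interpolation.

Lemma interpolating_rank (R : realType) (C : category) (hC : has_finite_colimits C)
    (p : forall a b : C, mor a b -> int) (hp : persistence_function p)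
    (F G : functor (real_poset R) C) (e d : R) :
  interleaved e F G -> e <= d ->
  exists r : R * R -> R * R -> int,
    [/\ rank_function (@grid_le R) r,
        forall (x y : R) (xy : x <= y), r (x, x - d) (y, y - d) = pdiag p F xy
      & forall (x y : R) (xy : x <= y), r (x - d, x) (y - d, y) = pdiag p G xy].
Proof.
move=> [e0 [phi [psi [psiphi phipsi]]]] ed.
exists (diagram_rank p (amal_map ed psiphi phipsi hC)); split.
- exact: grid_rankP.
- exact: grid_rank_inl.
- exact: grid_rank_inr.
Qed.

(** * Diagrams of finite chains *)

Section ChainDiagrams.
Local Open Scope nat_scope.

Lemma sumr_telescope2 (r : nat -> nat -> int) (x y N : nat) : y <= N ->
  (\sum_(0 <= a < x) \sum_(y <= b < N)
     (r a.+1 b - r a b - r a.+1 b.+1 + r a b.+1) =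
   r x y - r 0%N y - r x N + r 0%N N)%R.
Proof.
move=> yN.
have inner a : (\sum_(y <= b < N) (r a.+1 b - r a b - r a.+1 b.+1 + r a b.+1) =
   (r a.+1 y - r a.+1 N) - (r a y - r a N))%R.
  rewrite (telescope_sumr_eq (fun b => (r a b - r a.+1 b)%R)) //; first by lia.
  by move=> b _; lia.
under eq_bigr do rewrite inner.
rewrite (telescope_sumr_eq (fun a => (r a y - r a N)%R)) //; lia.
Qed.

Definition chain_mult (r : nat -> nat -> int) (a b : nat) : int :=
  (r a.+1 b - r a b - r a.+1 b.+1 + r a b.+1)%R.

Definition chain_points (N : nat) (r : nat -> nat -> int) : seq (nat * nat) :=
  flatten [seq nseq `|chain_mult r q.1 q.2| (q.1.+1, q.2.+1)
          | q <- [seq (a, b) | a <- iota 0 N, b <- iota 0 N] & q.1 < q.2].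

Definition in_range (N : nat) (q : nat * nat) := [&& 0 < q.1, q.1 <= q.2 & q.2 <= N].

(** A point is present from its first coordinate on and gone at its second, so a diagonal point
    spans nothing when [x <= y]. *)
Definition spans (x y : nat) (q : nat * nat) := (q.1 <= x) && (y < q.2).

Definition represents (N : nat) (base : int) (r : nat -> nat -> int) (L : seq (nat * nat)) :=
  all (in_range N) L /\
  forall x y, x <= y <= N -> (count (spans x y) L)%:Z = (r x y - base)%R.

(** Telescoping recovers the rank from its second differences, since all boundary terms equal
    [base]. The third rank axiom makes these differences nonnegative, so the absolute value used as
    number of copies loses nothing. *)
Lemma chain_pointsP (N : nat) (base : int) (r : nat -> nat -> int) :
  rank_function leq r -> (forall x, r 0 x = base) -> (forall x, r x N = base) ->
  represents N base r (chain_points N r).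
Proof.
move=> [_ _ r3] r0 rN; split.
  apply/allP => q /flattenP[s /mapP[[a b]]].
  rewrite mem_filter => /andP[/= ab /allpairsP[[a' b'] /= [+ + [? ?]]]]; subst a' b'.
  rewrite !mem_iota => aN bN -> /nseqP[-> _]; rewrite /in_range /=; lia.
move=> x y /andP[xy yN].
rewrite count_flatten sumnE !big_map big_filter big_mkcond big_allpairs /=.
rewrite -[RHS]/(_)%R.
have -> : (r x y - base = r x y - r 0%N y - r x N + r 0%N N)%R by rewrite !r0 rN; lia.
rewrite -sumr_telescope2 // (big_morph Posz PoszD erefl).
rewrite (big_nat_widen 0 x N); last by lia.
have iN : iota 0 N = index_iota 0 N by rewrite /index_iota subn0.
rewrite iN [RHS]big_mkcond; apply: eq_big_nat => a aN /=.
rewrite (big_morph Posz PoszD erefl); case: (ltnP a x) => ax; last first.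
  by apply: big1_seq => b _; rewrite count_nseq /spans /= (ltnNge a x) ax /= mul0n if_same.
rewrite (big_nat_widenl y 0) // [RHS]big_mkcond; apply: eq_big_nat => b bN /=.
rewrite count_nseq /spans /= ltnS ax /=; case: (leqP y b) => yb; last first.
  by rewrite mul0n if_same.
have ab : a < b by lia.
have := r3 a a.+1 b b.+1 (leqnSn a) ab (leqnSn b).
by rewrite ab mul1n /chain_mult; lia.
Qed.

(** [h] is left adjoint to the inclusion [iota] of the subchain, that is, rounding up. Hence a point
    spans [iota x], [iota y] exactly when its rounding spans [x], [y]. *)
Lemma represents_coarsen (N K : nat) (base : int) (r : nat -> nat -> int)
    (L : seq (nat * nat)) (h iota : nat -> nat) :
  (forall x y, x <= y <= K -> iota x <= iota y) -> iota 0 = 0 -> iota K = N ->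
  (forall q x, 0 < q <= N -> x <= K -> (h q <= x) = (q <= iota x)) ->
  represents N base r L ->
  represents K base (fun x y => r (iota x) (iota y)) [seq (h q.1, h q.2) | q <- L].
Proof.
move=> iota_mono iota0 iotaK hP [/allP Lr Lc]; split.
  apply/allP => q' /mapP[q /Lr + ->]; move: (q : nat * nat) => {}q /and3P[q0 q12 qN].
  apply/and3P; split => /=.
  - by rewrite ltnNge (hP q.1 0) ?iota0; lia.
  - have h2 : h q.2 <= K by rewrite hP ?iotaK; lia.
    have q1N : 0 < q.1 <= N by rewrite q0 (leq_trans q12).
    have q2N : 0 < q.2 <= N by rewrite (leq_trans q0).
    by rewrite hP //; apply: leq_trans q12 _; rewrite -hP.
  - by rewrite hP ?iotaK; lia.
move=> x y /andP[xy yK]; rewrite -Lc; last first.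
  by rewrite iota_mono ?xy //= -iotaK iota_mono // yK /=.
rewrite count_map; congr Posz.
apply: eq_in_count => q /Lr; move: (q : nat * nat) => {}q /and3P[q0 q12 qN].
rewrite /spans /= (hP q.1 x) 1?(ltnNge y) 1?(ltnNge (iota y)) ?(hP q.2 y) //; lia.
Qed.

Lemma represents_count (N : nat) (base : int) (r : nat -> nat -> int)
    (L : seq (nat * nat)) (a b : nat) :
  a < b < N -> represents N base r L ->
  (count_mem (a.+1, b.+1) L)%:Z = chain_mult r a b.
Proof.
move=> abN [Lr Lc].
have -> : (chain_mult r a b = (count (spans a.+1 b) L)%:Z - (count (spans a b) L)%:Z
   - (count (spans a.+1 b.+1) L)%:Z + (count (spans a b.+1) L)%:Z)%R.
  by rewrite !Lc /chain_mult; lia.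
elim: L {Lr Lc} => //= q L IH; rewrite !PoszD IH.
have -> : (q == (a.+1, b.+1)) = (q.1 == a.+1) && (q.2 == b.+1) by case: q.
rewrite /spans; lia.
Qed.

Definition off_diag (q : nat * nat) := q.1 != q.2.

(** Off the diagonal the numbers of copies are second differences of the rank, hence forced; on the
    diagonal they are arbitrary. *)
Lemma represents_perm (N : nat) (base : int) (r : nat -> nat -> int)
    (L L' : seq (nat * nat)) :
  represents N base r L -> represents N base r L' ->
  perm_eq [seq q <- L | off_diag q] [seq q <- L' | off_diag q].
Proof.
move=> rL rL'; apply/allP => -[a b] /=; rewrite mem_cat !mem_filter => ab.
have {ab} : (0 < a) && (a < b <= N).
  have [[/allP L1 _] [/allP L2 _]] := (rL, rL').
  by case/orP: ab => /andP[ab] => [/L1|/L2]; rewrite /in_range /off_diag /= in ab *; lia.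
case: a b => [//|a] [|b] /= abN; first lia.
rewrite !count_filter.
rewrite (eq_count (a2 := pred1 (a.+1, b.+1))); last first.
  by move=> q /=; case: eqP => // -> /=; rewrite /off_diag /=; lia.
rewrite [X in _ == X](eq_count (a2 := pred1 (a.+1, b.+1))); last first.
  by move=> q /=; case: eqP => // -> /=; rewrite /off_diag /=; lia.
by rewrite -eqz_nat (represents_count _ rL) 1?(represents_count _ rL') //; lia.
Qed.

Lemma represents_off_diag (N : nat) (base : int) (r : nat -> nat -> int)
    (L L' : seq (nat * nat)) :
  all (in_range N) L' -> perm_eq [seq q <- L | off_diag q] [seq q <- L' | off_diag q] ->
  represents N base r L -> represents N base r L'.
Proof.
move=> L'r LL' [Lr Lc]; split => // x y xy; rewrite -Lc //; congr Posz.
have red M : count (spans x y) M = count (spans x y) [seq q <- M | off_diag q].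
  rewrite count_filter; apply: eq_count => q /=; rewrite /spans /off_diag; lia.
by rewrite red (red L); apply/esym/permP.
Qed.

(** Matchings are lists of pairs, so multiplicities need no labels; two of them compose once their
    middle multisets coincide. *)
Lemma perm_compose (A B D : eqType) (s : seq (A * B)) (t : seq (B * D)) :
  perm_eq (unzip2 s) (unzip1 t) ->
  exists L : seq (A * D), [/\ perm_eq (unzip1 L) (unzip1 s), perm_eq (unzip2 L) (unzip2 t)
    & forall x, x \in L -> exists y, (x.1, y) \in s /\ (y, x.2) \in t].
Proof.
elim: s t => [|[a b] s IH] t /=.
  by rewrite perm_sym => /perm_nilP; case: t => // _; exists [::].
move=> st; have : b \in unzip1 t by rewrite -(perm_mem st) mem_head.
case/mapP=> -[b' c] bct /= bb'; subst b'.
have tt := perm_to_rem bct.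
have {}st : perm_eq (unzip2 s) (unzip1 (rem (b, c) t)).
  by rewrite -(perm_cons b); apply: perm_trans st _; exact: (perm_map fst tt).
have [L [L1 L2 L3]] := IH _ st.
exists ((a, c) :: L); split => /=; first by rewrite perm_cons.
  rewrite perm_sym; apply: perm_trans (perm_map snd tt) _.
  by rewrite /= perm_cons perm_sym.
move=> x; rewrite inE => /orP[/eqP -> | /L3[y [xs ys]]].
  by exists b; rewrite mem_head.
by exists y; rewrite inE xs orbT; split=> //; exact: mem_rem ys.
Qed.

(** Indices only fall along the sequence of chains, hence the one-sided bound. Starting the second
    grid at offset [d = s * E] turns a fall of [0] to [2 * E] steps into a displacement between [-d]
    and [d]. *)
Definition drift (k : nat) (x : (nat * nat) * (nat * nat)) :=
  (x.2.1 <= x.1.1 <= x.2.1 + k) && (x.2.2 <= x.1.2 <= x.2.2 + k).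

Definition matched (N : nat) (base : int) (k : nat) (r r' : nat -> nat -> int) :=
  exists L : seq ((nat * nat) * (nat * nat)),
    [/\ represents N base r (unzip1 L), represents N base r' (unzip2 L) & all (drift k) L].

(** The middle lists agree only off the diagonal. Pairs meeting there are composed; a pair whose
    middle point is diagonal is kept as it stands, which adds only a diagonal point to the list at
    that end. *)
Lemma matched_trans (N : nat) (base : int) (k l : nat) (r r' r'' : nat -> nat -> int) :
  matched N base k r r' -> matched N base l r' r'' -> matched N base (k + l) r r''.
Proof.
move=> [L [L1 L2 /allP Lk]] [M [M1 M2 /allP Ml]].
pose Lo := [seq x <- L | off_diag x.2]; pose Ld := [seq x <- L | ~~ off_diag x.2].
pose Mo := [seq x <- M | off_diag x.1]; pose Md := [seq x <- M | ~~ off_diag x.1].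
have LM : perm_eq (unzip2 Lo) (unzip1 Mo).
  rewrite /unzip1 /unzip2 -!filter_map; exact: represents_perm L2 M1.
have [T [T1 T2 T3]] := perm_compose LM.
have LL : perm_eq (Lo ++ Ld) L by exact/permEl/perm_filterC.
have MM : perm_eq (Mo ++ Md) M by exact/permEl/perm_filterC.
have d1 (X : seq ((nat * nat) * (nat * nat))) :
    [seq x <- unzip1 [seq x <- X | ~~ off_diag x.1] | off_diag x] = [::].
  by elim: X => //= x X IH; case: ifP => //= /negbTE ->.
have d2 (X : seq ((nat * nat) * (nat * nat))) :
    [seq x <- unzip2 [seq x <- X | ~~ off_diag x.2] | off_diag x] = [::].
  by elim: X => //= x X IH; case: ifP => //= /negbTE ->.
have P1 : perm_eq (unzip1 (T ++ Ld ++ Md)) (unzip1 L ++ unzip1 Md).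
  rewrite /unzip1 !map_cat catA perm_cat2r.
  apply: perm_trans (perm_map fst LL); rewrite map_cat perm_cat2r; exact: T1.
have P2 : perm_eq (unzip2 (T ++ Ld ++ Md)) (unzip2 M ++ unzip2 Ld).
  rewrite /unzip2 !map_cat.
  apply: (@perm_trans _ (map snd T ++ map snd Md ++ map snd Ld)).
    by rewrite perm_cat2l perm_catC.
  rewrite catA perm_cat2r.
  apply: perm_trans (perm_map snd MM); rewrite map_cat perm_cat2r; exact: T2.
have sub1 : {subset unzip1 Md <= unzip1 M}.
  by apply: mem_subseq; apply: map_subseq; exact: filter_subseq.
have sub2 : {subset unzip2 Ld <= unzip2 L}.
  by apply: mem_subseq; apply: map_subseq; exact: filter_subseq.
exists (T ++ Ld ++ Md); split.
- apply: represents_off_diag (L1).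
    rewrite (perm_all _ P1) all_cat L1.1 /=; apply/allP => q /sub1; exact: (allP M1.1).
  by rewrite perm_sym; apply: perm_trans (perm_filter _ P1) _; rewrite filter_cat d1 cats0.
- apply: represents_off_diag (M2).
    rewrite (perm_all _ P2) all_cat M2.1 /=; apply/allP => q /sub2; exact: (allP L2.1).
  by rewrite perm_sym; apply: perm_trans (perm_filter _ P2) _; rewrite filter_cat d2 cats0.
apply/allP => x; rewrite !mem_cat => /or3P[/T3[y [xy yx]]||].
- move: xy yx; rewrite !mem_filter => /andP[_ /Lk +] /andP[_ /Ml]; rewrite /drift /=; lia.
- by rewrite mem_filter => /andP[_ /Lk]; rewrite /drift; lia.
- by rewrite mem_filter => /andP[_ /Ml]; rewrite /drift; lia.
Qed.

(* Indices [0] and [N] are sentinels standing for the infinite coordinates. *)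
Definition sentinel_rank (N : nat) (base : int) (r : nat -> nat -> int) (i j : nat) : int :=
  if (i == 0) || (N <= j) then base else r i j.

(** Since [base] is a lower bound of [r], the inequalities that involve a sentinel reduce to
    monotonicity or to [base <= r x y]. *)
Lemma sentinel_rankP (T : Type) (le : rel T) (r : T -> T -> int) (N : nat) (base : int)
    (z : nat -> T) :
  rank_function le r -> (forall x y, le x y -> (base <= r x y)%R) ->
  (forall i j, 0 < i <= j -> le (z i) (z j)) ->
  rank_function leq (sentinel_rank N base (fun i j => r (z i) (z j))).
Proof.
move=> [r1 r2 r3] rb mono; rewrite /sentinel_rank; split.
- move=> a b c ab bc; case: (leqP N c) => Nc; rewrite ?orbT //= !orbF.
  have [b0|b0] := posnP b; first by rewrite (_ : a == 0) //; lia.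
  have [a0|a0] := posnP a; first by rewrite rb // mono // b0.
  by apply: r1; rewrite mono // ?a0 ?b0.
- move=> a b c ab bc.
  have [a0|a0] := posnP a; first by [].
  case: (leqP N b) => Nb /=; first by rewrite (leq_trans Nb bc).
  case: (leqP N c) => Nc /=; first by rewrite rb // mono // a0.
  by apply: r2; rewrite mono // ?a0; lia.
- move=> a b c d ab bc cd.
  have [b0|b0] := posnP b; first by rewrite (_ : a == 0) /= ?subrr //; lia.
  case: (leqP N c) => Nc /=; first by rewrite !orbT (leq_trans Nc cd) !orbT subrr.
  have bc' : le (z b) (z c) by rewrite mono // b0.
  have [a0|a0] := posnP a.
    case: (leqP N d) => Nd; rewrite /= ?orbF ?orbT ?subrr ?subr_ge0 ?rb // lerD2r.
    by apply: r2 bc' _; rewrite mono //; lia.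
  have ab' : le (z a) (z b) by rewrite mono // a0.
  case: (leqP N d) => Nd; rewrite /= ?orbF ?orbT ?subrr ?subr_ge0; first exact: r1.
  by apply: r3 => //; rewrite mono //; lia.
Qed.

(** * Sequences of mutually interleaved chains *)

Section ChainSequence.
Variables (T : Type) (le : rel T) (r : T -> T -> int) (base : int) (n : nat).
Variable z : nat -> nat -> T.
Hypothesis le_refl : forall x, le x x.
Hypothesis le_tr : forall x y w, le x y -> le y w -> le x w.
Hypothesis rP : rank_function le r.
Hypothesis r_base : forall x y, le x y -> (base <= r x y)%R.
Hypothesis z_step : forall c i, le (z c i) (z c.+1 i).
Hypothesis z_interleave : forall c i, le (z c.+1 i) (z c i.+1).

Let chain (c : nat) := sentinel_rank n.+1 base (fun i j => r (z c i) (z c j)).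

(* The common refinement [z c 1 <= z c.+1 1 <= z c 2 <= z c.+1 2 <= ...] of two
   successive chains. *)
Let staircase (c i : nat) : T := if odd i then z c i./2.+1 else z c.+1 i./2.

Let staircase_le (c i j : nat) : 0 < i <= j -> le (staircase c i) (staircase c j).
Proof.
move=> /andP[_ /subnK <-]; elim: (j - i) => [|m IH]; first exact: le_refl.
rewrite addSn; apply: le_tr IH _; rewrite /staircase /= uphalf_half.
by case: (odd (m + i)) => /=; [exact: z_step | exact: z_interleave].
Qed.

(** In the staircase, [z c i] has index [2 i - 1] and [z c.+1 i] has index [2 i]. The left adjoints
    of these inclusions, [q./2.+1] and [uphalf q], differ by at most one, so rounding each point of
    the staircase in both ways gives the pairs. *)
Lemma matched_step (c : nat) : matched n.+1 base 1 (chain c) (chain c.+1).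
Proof.
pose s := sentinel_rank n.*2.+1 base (fun i j => r (staircase c i) (staircase c j)).
have sP : represents n.*2.+1 base s (chain_points n.*2.+1 s).
  apply: chain_pointsP; last by move=> x; rewrite /s /sentinel_rank leqnn orbT.
    exact: sentinel_rankP rP r_base (@staircase_le c).
  by [].
set L := chain_points _ _ in sP.
exists [seq ((q.1./2.+1, q.2./2.+1), (uphalf q.1, uphalf q.2)) | q <- L]; split.
- have [||||H1 H2] := @represents_coarsen _ n.+1 _ _ _ (fun q => q./2.+1)
    (fun x => x.*2.-1) _ _ _ _ sP; [lia|lia|lia|lia|].
  rewrite /unzip1 -map_comp; split => // x y xy; rewrite H2 // /s /chain /sentinel_rank.
  have sE i : staircase c i.+1.*2.-1 = z c i.+1.
    by rewrite /staircase doubleS /= odd_double /= uphalf_double.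
  case: x y xy => [//|x] [|y] xy; first lia.
  have -> : n.*2 < y.+1.*2.-1 = (n < y.+1) by lia.
  by rewrite !sE.
(* The minimum sends the sentinel [n.+1] to the sentinel [n.*2.+1] and not one further. *)
- have [||||H1 H2] := @represents_coarsen _ n.+1 _ _ _ uphalf
    (fun x => minn x.*2 n.*2.+1) _ _ _ _ sP; [lia|lia|lia|lia|].
  rewrite /unzip2 -map_comp; split => // x y xy; rewrite H2 // /s /chain /sentinel_rank.
  have sE i : staircase c i.*2 = z c.+1 i by rewrite /staircase odd_double doubleK.
  case: x xy => [|x] xy; first by rewrite min0n.
  case: (leqP n.+1 y) => ny.
    have -> : minn y.*2 n.*2.+1 = n.*2.+1 by lia.
    by rewrite ltnSn !orbT.
  have -> : minn y.*2 n.*2.+1 = y.*2 by lia.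
  have -> : minn x.+1.*2 n.*2.+1 = x.+1.*2 by lia.
  have -> : (n.*2 < y.*2) = false by lia.
  by rewrite !sE.
- rewrite all_map; apply/allP => q _; rewrite /drift /=; lia.
Qed.

Lemma matched_chain (k : nat) : matched n.+1 base k (chain 0) (chain k).
Proof.
elim: k => [|k IH]; last by have := matched_trans IH (matched_step k); rewrite addn1.
have [L [L1 _ _]] := matched_step 0.
exists [seq (q, q) | q <- unzip1 L]; rewrite /unzip1 /unzip2 -!map_comp.
rewrite !(eq_map (g := fst)) //; split => //.
by rewrite all_map; apply/allP => q _; rewrite /drift /=; lia.
Qed.

End ChainSequence.
End ChainDiagrams.

(** * Multiplicities *)

Lemma min_ofP (A : set int) (m : int) : A !=set0 -> (forall n, A n -> m <= n) ->
  A (min_of A) /\ forall n, A n -> min_of A <= n.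
Proof.
move=> [a Aa] mA; suff [x [Ax lx]] : exists x, A x /\ forall n, A n -> x <= n.
  rewrite /min_of; case: xgetP => [y -> [Ay ly]|/(_ x)[]]; first by split.
  by split.
have [k Ak] : exists k : nat, `[< A (m + k%:Z) >].
  exists `|a - m|%N; apply/asboolP; have := mA a Aa => ma.
  by rewrite (_ : m + _ = a) //; lia.
have exk : exists k : nat, `[< A (m + k%:Z) >] by exists k.
case: (ex_minnP exk) => n /asboolP An nmin; exists (m + n%:Z); split=> // b Ab.
have mb := mA b Ab.
have : (n <= `|b - m|)%N.
  by apply: nmin; apply/asboolP; rewrite (_ : m + _ = b) //; lia.
lia.
Qed.

Definition box (T : Type) (r : T -> T -> int) (a b c d : T) : int :=
  r b c - r a c - r b d + r a d.

Lemma connected_between_closure (T : topologicalType) (A B : set T) :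
  connected A -> A `<=` B -> B `<=` closure A -> connected B.
Proof.
move=> cA AB BA D D0 [U oU DU] [V cV DV].
have AU : A `&` D = A `&` U.
  by rewrite DU setIA; congr (_ `&` _); apply/setIidPl.
have AV : A `&` D = A `&` V.
  by rewrite DV setIA; congr (_ `&` _); apply/setIidPl.
have AD : A `&` D = A.
  apply: cA; [|by exists U|by exists V].
  case: D0 => x Dx; have : (B `&` U) x by rewrite -DU.
  move=> [Bx Ux]; rewrite AU; apply: (BA x Bx).
  exact: open_nbhs_nbhs.
have AsubV : A `<=` V by rewrite -AD AV; exact: subIsetr.
rewrite DV; apply/setIidPl; apply: subset_trans BA _.
by rewrite [X in _ `<=` X](closure_id V).1 //; exact: closureS.
Qed.

(** * Connected neighbourhoods in the extended line *)

Section ExtendedIntervals.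
Variable R : realType.
Implicit Types x y u : \bar R.

Lemma ereal_between x y : (x < y)%E -> exists t : R, (x < t%:E)%E /\ (t%:E < y)%E.
Proof.
case: x y => [x| |] [y| |] //=; rewrite ?lte_fin => xy.
- by exists ((x + y) / 2); rewrite !lte_fin; split; lra.
- by exists (x + 1); rewrite lte_fin ltry ltrDl.
- by exists (y - 1); rewrite lte_fin ltNyr gtrBl.
- by exists 0; rewrite ltry ltNyr.
Qed.

Lemma connected_ereal_interval (I : set (\bar R)) x y u :
  connected I -> I x -> I y -> (x <= u)%E -> (u <= y)%E -> I u.
Proof.
move=> cI Ix Iy; rewrite le_eqVlt => /orP[/eqP <- //|xu].
rewrite le_eqVlt => /orP[/eqP -> //|uy]; apply: contrapT => nIu.
have : I `&` [set t | (t < u)%E] = I.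
  apply: cI; first by exists x.
  - by exists [set t | (t < u)%E] => //; exact: open_ereal_lt_ereal.
  - exists [set t | (t <= u)%E]; first exact: closed_ereal_ge_ereal.
    apply/seteqP; split=> t [It] /=; first by move/ltW.
    by rewrite le_eqVlt => /orP[/eqP tu|//]; move: nIu; rewrite -tu.
move/seteqP => [_ /(_ y Iy) [_]] /=; by rewrite ltNge (ltW uy).
Qed.

(* The interval from [x] to [y], open except that it contains its infinite endpoints. *)
Definition cell x y : set (\bar R) :=
  [set t | ((x < t)%E \/ t = -oo%E /\ x = -oo%E) /\ ((t < y)%E \/ t = +oo%E /\ y = +oo%E)].

Lemma cell_fin x y (t : R) : cell x y t%:E <-> (x < t%:E)%E /\ (t%:E < y)%E.
Proof. by split=> [[[?|[]//] [?|[]//]]|[? ?]]; split=> //; left. Qed.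

Lemma cell_bounds x y u : cell x y u -> [/\ (x <= u)%E, (u <= y)%E & (x < y)%E].
Proof.
move=> [xu uy].
have xu' : (x <= u)%E by case: xu => [/ltW|[-> ->]].
have uy' : (u <= y)%E by case: uy => [/ltW|[-> ->]].
split=> //; case: xu => [xu|[u0 x0]]; first exact: lt_le_trans uy'.
by case: uy => [uy|[]]; rewrite x0 -?u0 // u0.
Qed.

Lemma cell_disjoint x y z w : (y <= z)%E -> cell x y `&` cell z w = set0.
Proof.
move=> yz; rewrite -subset0 => t [[_ ty] [zt _]].
case: ty => [ty|[t1 y1]]; case: zt => [zt|[t0 z0]].
- by have := lt_trans (lt_le_trans ty yz) zt; rewrite ltxx.
- by have := lt_le_trans ty yz; rewrite t0 z0 ltxx.
- by have := le_lt_trans yz zt; rewrite t1 y1 ltxx.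
- by move: t1; rewrite t0.
Qed.

Lemma cell_nbhs x y u : cell x y u -> nbhs u (cell x y).
Proof.
move=> [xu uy]; apply: filterI.
- case: xu => [xu|[-> ->]].
    by have := open_ereal_gt' xu; apply: filterS => t; left.
  apply: filterS filterT => t _; case: t => [t| |]; [left|left|right] => //=;
    by rewrite ?ltNyr ?ltNy0.
- case: uy => [uy|[-> ->]].
    by have := open_ereal_lt' uy; apply: filterS => t; left.
  apply: filterS filterT => t _; case: t => [t| |]; [left|right|left] => //=;
    by rewrite ?ltry.
Qed.

(** A cell lies between its finite part, the image of a real interval, and the closure of that
    part. *)
Lemma cell_connected x y : (x < y)%E -> connected (cell x y).
Proof.
move=> xy; pose A := [set t : R | (x < t%:E)%E /\ (t%:E < y)%E].
have cA : connected (EFin @` A).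
  apply: connected_continuous_connected.
    apply/connected_intervalP => s t [xs sy] [xt ty] w /andP[sw wt]; split.
      by apply: lt_le_trans xs _; rewrite lee_fin.
    by apply: le_lt_trans ty; rewrite lee_fin.
  by apply: continuous_subspaceT => t P.
apply: connected_between_closure cA _ _.
  by move=> _ [t [xt ty] <-]; exact/cell_fin.
move=> [t| |].
- by move/cell_fin => tA; apply: subset_closure; exists t.
- move=> [_ [|[_ yoo]]]; first by rewrite ltNge leey.
  move=> B [M [_ MB]].
  have xM : (maxe x M%:E < +oo)%E by rewrite gt_max ltry andbT -yoo.
  have [t [+ _]] := ereal_between xM; rewrite gt_max => /andP[xt Mt].
  by exists t%:E; split; [exists t => //; split=> //; rewrite yoo ltry | exact: MB].
- move=> [[xlt|[_ xoo]] _]; first by move: xlt; rewrite ltNge leNye.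
  move=> B [M [_ MB]].
  have yM : (-oo < mine y M%:E)%E by rewrite lt_min ltNyr andbT -xoo.
  have [t [_ +]] := ereal_between yM; rewrite lt_min => /andP[ty tM].
  by exists t%:E; split; [exists t => //; split=> //; rewrite xoo ltNyr | exact: MB].
Qed.

Lemma ereal_sup_cell x y : (x < y)%E -> ereal_sup (cell x y) = y.
Proof.
move=> xy; apply/eqP; rewrite eq_le; apply/andP; split.
  by apply: ge_ereal_sup => t [_ [/ltW|[_ ->]]] //; exact: leey.
rewrite leNgt; apply/negP => sy.
have my : (maxe x (ereal_sup (cell x y)) < y)%E by rewrite gt_max xy.
have [t [+ ty]] := ereal_between my; rewrite gt_max => /andP[xt].
by rewrite ltNge ereal_sup_ubound //; exact/cell_fin.
Qed.

Lemma ereal_inf_cell x y : (x < y)%E -> ereal_inf (cell x y) = x.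
Proof.
move=> xy; apply/eqP; rewrite eq_le; apply/andP; split; last first.
  by apply: le_ereal_inf_tmp => t [[/ltW|[_ ->]] _] //; exact: leNye.
rewrite leNgt; apply/negP => sx.
have xm : (x < mine y (ereal_inf (cell x y)))%E by rewrite lt_min xy.
have [t [xt]] := ereal_between xm; rewrite lt_min => /andP[ty].
by rewrite ltNge ereal_inf_lbound //; exact/cell_fin.
Qed.

End ExtendedIntervals.

Lemma box_ge0 (T : Type) (le : rel T) (r : T -> T -> int) (a b c d : T) :
  rank_function le r -> le a b -> le b c -> le c d -> 0 <= box r a b c d.
Proof. move=> [_ _ r3] ab bc cd; have := r3 _ _ _ _ ab bc cd; rewrite /box; lia. Qed.

(** [box] is additive under cutting: the outer rectangle is the inner one plus four others, all
    nonnegative. *)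
Lemma box_mono (T : Type) (le : rel T) (r : T -> T -> int) (i a b j k c d l : T) :
  (forall x y z, le x y -> le y z -> le x z) -> rank_function le r ->
  le i a -> le a b -> le b j -> le j k -> le k c -> le c d -> le d l ->
  box r a b c d <= box r i j k l.
Proof.
move=> tr rP ia ab bj jk kc cd dl.
have ck := tr _ _ _ kc cd; have bk := tr _ _ _ bj jk.
have := box_ge0 rP ia (tr _ _ _ ab bk) (tr _ _ _ ck dl).
have := box_ge0 rP bj jk (tr _ _ _ ck dl).
have := box_ge0 rP ab bk kc.
have := box_ge0 rP ab (tr _ _ _ bk ck) dl.
rewrite /box; lia.
Qed.

Section LocallyConstant.
Variable R : realType.

(** The points where [f] equals [f x] form an open and closed part of the connected segment. *)
Lemma locally_constant_segment (T : Type) (f : R -> T) (x y : R) : x <= y ->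
  (forall t, x <= t <= y -> \forall s \near t, f s = f t) -> f x = f y.
Proof.
move=> xy fl; have xin : x \in `[x, y] by rewrite in_itv /= lexx.
pose B := [set t | x <= t <= y /\ f t = f x].
suff : B = [set` `[x, y]].
  by move/seteqP => [_ /(_ y)]; rewrite /= in_itv /= xy lexx => /(_ isT)[_ <-].
apply: segment_connected.
- by exists x; split => //; rewrite lexx.
- exists (interior [set s | f s = f x]); first exact: open_interior.
  apply/seteqP; split=> t /=; rewrite in_itv /=.
    by move=> [txy tx]; split=> //; move: (fl t txy); rewrite tx.
  by move=> [txy] /nbhs_singleton.
- exists (~` interior [set s | f s <> f x]).
    by apply: open_closedC; exact: open_interior.
  apply/seteqP; split=> t /=; rewrite in_itv /=.
    by move=> [txy tx]; split=> // /nbhs_singleton /=.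
  move=> [txy nt]; split=> //; apply: contrapT => ft; apply: nt.
  by have := fl t txy; rewrite /interior /=; apply: filterS => s /= ->.
Qed.

End LocallyConstant.

(** * Multiplicities and critical values *)

Section Multiplicity.
Variables (R : realType) (C : category) (p : forall a b : C, mor a b -> int).
Hypothesis hp : persistence_function p.
Variable F : functor (real_poset R) C.
Implicit Types x y z w u v : \bar R.

Let real_rank := diagram_rank p (fun (x y : R) (xy : x <= y) => @fmor _ _ F x y xy).

Let real_rankP : rank_function (fun x y : R => x <= y) real_rank.
Proof.
apply: diagram_rankP => // [x y z|x y z xz yz xy]; first exact: le_trans.
exact: fmor_trans.
Qed.

Lemma pdiag_extE (x y : R) (xy : x <= y) : pdiag_ext p F x%:E y%:E = pdiag p F xy.
Proof. exact: (diagram_rankE p _ xy). Qed.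

Lemma pdiag_minP :
  (exists (x y : R) (xy : x <= y), pdiag_min p F = pdiag p F xy) /\
  forall (x y : R) (xy : x <= y), pdiag_min p F <= pdiag p F xy.
Proof.
have [[m mp] _ _ _] := hp.
have [||H1 H2] := @min_ofP [set n | exists (x y : R) (xy : x <= y), n = pdiag p F xy] m.
- by exists (pdiag p F (lexx (0 : R))), 0, 0, (lexx 0).
- by move=> n [x [y [xy ->]]]; exact: mp.
- by split=> // x y xy; apply: H2; exists x, y, xy.
Qed.

Lemma pdiag_ext_rank : rank_function (fun u v => (u <= v)%E) (pdiag_ext p F).
Proof.
have [r1 r2 r3] := real_rankP; have [_ pm] := pdiag_minP.
have pm' (x y : R) : x <= y -> pdiag_min p F <= pdiag_ext p F x%:E y%:E.
  by move=> xy; rewrite pdiag_extE.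
split.
- move=> [a| |] [b| |] [c| |] //=; rewrite ?lee_fin // => ab bc; [exact: r1|exact: pm'].
- move=> [a| |] [b| |] [c| |] //=; rewrite ?lee_fin // => ab bc; [exact: r2|exact: pm'].
- move=> [a| |] [b| |] [c| |] [d| |] //=; rewrite ?lee_fin ?subrr ?subr_ge0 // => ab bc cd.
  + exact: r3.
  + exact: r1.
  + by rewrite lerD2r; exact: r2.
  + exact: pm'.
Qed.

(** Where [F] is constant, the rectangle axiom bounds the gain from [a] to [b] seen at any [c]
    beyond [b] by the gain seen at [b], which is zero. The resulting local equalities propagate
    along the segment. *)
Lemma regular_segment (x y : R) : x <= y ->
  (forall t, x <= t <= y -> regular_value p F t) ->
  (forall c, (y%:E <= c)%E -> pdiag_ext p F x%:E c = pdiag_ext p F y%:E c) /\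
  (forall c, (c <= x%:E)%E -> pdiag_ext p F c x%:E = pdiag_ext p F c y%:E).
Proof.
move=> xy reg; have [r1 r2 r3] := pdiag_ext_rank.
(* Clamping to the segment: local constancy is demanded on a full neighbourhood, while [pdiag_ext]
   is a default value once a finite first argument exceeds a finite second one. *)
pose cl t := Num.max x (Num.min t y).
have clP t : x <= cl t <= y by rewrite /cl le_max lexx ge_max xy ge_min lexx orbT.
have cl_id t : x <= t <= y -> cl t = t.
  by move=> /andP[xt ty]; rewrite /cl (min_idPl ty) (max_idPr xt).
have clI (I : set R) s t : connected I -> x <= t <= y -> I t -> I s -> I (cl s).
  move=> /connected_intervalP cI /andP[xt ty] It Is; rewrite /cl.
  have [sx|xs] := leP s x.
    rewrite (min_idPl _) ?(le_trans sx) // (max_idPl sx).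
    by apply: cI Is It _ _; rewrite sx.
  have [sy|ys] := leP s y; first by rewrite (max_idPr (ltW xs)).
  by rewrite (max_idPr xy); apply: cI It Is _ _; rewrite ty (ltW ys).
have key (I : set R) (a b : R) : a <= b -> constant_on p F I -> I a -> I b ->
    (forall c, (b%:E <= c)%E -> pdiag_ext p F a%:E c = pdiag_ext p F b%:E c) /\
    (forall c, (c <= a%:E)%E -> pdiag_ext p F c a%:E = pdiag_ext p F c b%:E).
  move=> ab cI Ia Ib; have := cI a b ab Ia Ib; rewrite -!pdiag_extE => -[e1 e2].
  have abE : (a%:E <= b%:E)%E by rewrite lee_fin.
  split=> c bc; apply/eqP; rewrite eq_le; apply/andP; split.
  - exact: r1.
  - by have := r3 _ _ _ _ abE (lexx _) bc; rewrite -e2 subrr; lia.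
  - by have := r3 _ _ _ _ bc (lexx _) abE; rewrite -e1; lia.
  - exact: r2.
have key' (I : set R) (a b : R) : constant_on p F I -> I a -> I b ->
    (forall c, (a%:E <= c)%E -> (b%:E <= c)%E -> pdiag_ext p F a%:E c = pdiag_ext p F b%:E c) /\
    (forall c, (c <= a%:E)%E -> (c <= b%:E)%E -> pdiag_ext p F c a%:E = pdiag_ext p F c b%:E).
  move=> cI Ia Ib; have [ab|/ltW ba] := leP a b.
    by have [k1 k2] := key I a b ab cI Ia Ib; split=> c ? ?; auto.
  by have [k1 k2] := key I b a ba cI Ib Ia; split=> c ? ?; apply/esym; auto.
split=> c xyc.
- rewrite -{1}(cl_id x) ?lexx ?xy // -(cl_id y) ?lexx ?xy //.
  apply: (locally_constant_segment (f := fun t => pdiag_ext p F (cl t)%:E c)) => // t txy.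
  have [I [nI coI cI]] := reg t txy.
  near=> s; have Is : I s by near: s.
  have It := nbhs_singleton nI.
  have [k _] := key' I (cl s) (cl t) cI (clI _ _ _ coI txy It Is) (clI _ _ _ coI txy It It).
  by apply: k; apply: le_trans xyc; rewrite lee_fin; case/andP: (clP s) (clP t) => ? ? /andP[].
- rewrite -{1}(cl_id x) ?lexx ?xy // -(cl_id y) ?lexx ?xy //.
  apply: (locally_constant_segment (f := fun t => pdiag_ext p F c (cl t)%:E)) => // t txy.
  have [I [nI coI cI]] := reg t txy.
  near=> s; have Is : I s by near: s.
  have It := nbhs_singleton nI.
  have [_ k] := key' I (cl s) (cl t) cI (clI _ _ _ coI txy It Is) (clI _ _ _ coI txy It It).
  by apply: k; apply: le_trans xyc _; rewrite lee_fin; case/andP: (clP s) (clP t) => ? ? /andP[].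
Unshelve. all: by end_near.
Qed.

(** Connected sets are convex, so disjointness puts [Iu] to the left of [Iv]. Thus every box in the
    definition of the multiplicity has its four arguments in increasing order. *)
Lemma connected_nbhs_bounds u v (Iu Iv : set (\bar R)) :
  (u < v)%E -> nbhs u Iu -> connected Iu -> nbhs v Iv -> connected Iv -> Iu `&` Iv = set0 ->
  [/\ (ereal_inf Iu <= u <= ereal_sup Iu)%E, (ereal_inf Iv <= v <= ereal_sup Iv)%E
    & (ereal_sup Iu <= ereal_inf Iv)%E].
Proof.
move=> uv /nbhs_singleton Iuu cu /nbhs_singleton Ivv cv dis; split.
- by rewrite ereal_inf_lbound // ereal_sup_ubound.
- by rewrite ereal_inf_lbound // ereal_sup_ubound.
apply: ge_ereal_sup => a Ia; apply: le_ereal_inf_tmp => b Ib.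
rewrite leNgt; apply/negP => ba.
have dis' t : Iu t -> Iv t -> False by move=> ? ?; have : (Iu `&` Iv) t by []; rewrite dis.
have [va|av] := leP v a.
  exact: dis' v (connected_ereal_interval cu Iuu Ia (ltW uv) va) Ivv.
exact: dis' a Ia (connected_ereal_interval cv Ib Ivv (ltW ba) (ltW av)).
Qed.

Lemma nbhs_inf_lt u (I : set (\bar R)) : nbhs u I -> u != -oo%E -> (ereal_inf I < u)%E.
Proof.
case: u => [u| |] // nI _.
- have /nbhs_ballP[e /= e0 eI] : nbhs u (fun r => I r%:E) by exact: nI.
  apply: (@le_lt_trans _ _ (u - e / 2)%:E); last by rewrite lte_fin; lra.
  apply: ereal_inf_lbound; apply: eI; rewrite /ball /=.
  by rewrite (_ : u - _ = e / 2) ?ger0_norm; lra.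
- have [M [_ MI]] := nI; apply: (@le_lt_trans _ _ (M + 1)%:E); last exact: ltry.
  by apply: ereal_inf_lbound; apply: MI; rewrite lte_fin; lra.
Qed.

Lemma nbhs_sup_gt u (I : set (\bar R)) : nbhs u I -> u != +oo%E -> (u < ereal_sup I)%E.
Proof.
case: u => [u| |] // nI _.
- have /nbhs_ballP[e /= e0 eI] : nbhs u (fun r => I r%:E) by exact: nI.
  apply: (@lt_le_trans _ _ (u + e / 2)%:E); first by rewrite lte_fin; lra.
  apply: ereal_sup_ubound; apply: eI; rewrite /ball /=.
  by rewrite (_ : u - _ = - (e / 2)) ?normrN ?ger0_norm; lra.
- have [M [_ MI]] := nI; apply: (@lt_le_trans _ _ (M - 1)%:E); first exact: ltNyr.
  by apply: ereal_sup_ubound; apply: MI; rewrite lte_fin; lra.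
Qed.

Let mult_set u v : set int := [set n | exists Iu Iv : set (\bar R),
    [/\ nbhs u Iu /\ connected Iu, nbhs v Iv /\ connected Iv, Iu `&` Iv = set0
      & n = box (pdiag_ext p F) (ereal_inf Iu) (ereal_sup Iu) (ereal_inf Iv) (ereal_sup Iv)]].

Lemma multiplicity_box_witness u v x y z w :
  cell x y u -> cell z w v -> (y <= z)%E -> mult_set u v (box (pdiag_ext p F) x y z w).
Proof.
move=> cu cv yz; have [_ _ xy] := cell_bounds cu; have [_ _ zw] := cell_bounds cv.
exists (cell x y), (cell z w); split.
- by split; [exact: cell_nbhs | exact: cell_connected].
- by split; [exact: cell_nbhs | exact: cell_connected].
- exact: cell_disjoint.
- by rewrite !ereal_inf_cell // !ereal_sup_cell.
Qed.

(** The cells show that the set is nonempty and [box_ge0] bounds it below, so [multiplicity] is a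
    true minimum and not the default of [min_of]. *)
Lemma multiplicityP u v x y z w :
  (u < v)%E -> cell x y u -> cell z w v -> (y <= z)%E ->
  mult_set u v (multiplicity p F u v) /\ forall n, mult_set u v n -> multiplicity p F u v <= n.
Proof.
move=> uv cu cv yz; apply: (min_ofP (m := 0)).
  by exists (box (pdiag_ext p F) x y z w); exact: multiplicity_box_witness.
move=> n [Iu [Iv [[nu cu'] [nv cv'] dis ->]]].
have [/andP[h1 h2] /andP[h3 h4] h5] := connected_nbhs_bounds uv nu cu' nv cv' dis.
apply: (box_ge0 pdiag_ext_rank) => //; [exact: le_trans h2 | exact: le_trans h4].
Qed.

Lemma multiplicity_le_box u v x y z w :
  (u < v)%E -> cell x y u -> cell z w v -> (y <= z)%E ->
  multiplicity p F u v <= box (pdiag_ext p F) x y z w.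
Proof.
by move=> uv cu cv yz; apply: (multiplicityP uv cu cv yz).2; exact: multiplicity_box_witness.
Qed.

(** A window around [u] whose closure has no finite critical value except possibly [u]. An infinite
    end is allowed only where [u] itself is that infinity, so the other ends can be moved through
    regular values. *)
Definition isolated x y u : Prop :=
  [/\ cell x y u, x = -oo%E -> u = -oo%E, y = +oo%E -> u = +oo%E
    & forall t : R, (x <= t%:E)%E -> (t%:E <= y)%E -> t%:E <> u -> regular_value p F t].

Lemma isolated_left x y u x' :
  isolated x y u -> (x <= x')%E -> (x' <= u)%E -> (u != -oo%E -> (x' < u)%E) ->
  (forall c, (x' <= c)%E -> pdiag_ext p F x c = pdiag_ext p F x' c) /\
  (forall c, (c <= x)%E -> pdiag_ext p F c x = pdiag_ext p F c x').
Proof.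
move=> [cu xoo _ reg] xx' x'u x'u'; have [_ uy _] := cell_bounds cu.
have [u0|/x'u' {}x'u'] := eqVneq u -oo%E.
  by have -> : x' = x by apply/eqP; rewrite eq_le xx' (le_trans x'u) // u0 leNye.
have x0 : x != -oo%E by apply/eqP => /xoo u0; move: x'u'; rewrite u0 ltNge leNye.
case: x xx' x0 reg cu xoo => [x| |] // xx' _ reg cu xoo; last first.
  by move: (le_lt_trans xx' x'u'); rewrite ltNge leey.
case: x' xx' x'u x'u' => [x'| |] // xx' x'u x'u'; last first.
  by move: x'u'; rewrite ltNge leey.
apply: regular_segment; first by rewrite -lee_fin.
move=> t /andP[xt tx']; have tu : (t%:E < u)%E by apply: le_lt_trans x'u'; rewrite lee_fin.
apply: reg; first by rewrite lee_fin.
- exact: le_trans (ltW tu) uy.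
- by move=> tE; move: tu; rewrite tE ltxx.
Qed.

Lemma isolated_right x y u y' :
  isolated x y u -> (y' <= y)%E -> (u <= y')%E -> (u != +oo%E -> (u < y')%E) ->
  (forall c, (y <= c)%E -> pdiag_ext p F y' c = pdiag_ext p F y c) /\
  (forall c, (c <= y')%E -> pdiag_ext p F c y' = pdiag_ext p F c y).
Proof.
move=> [cu _ yoo reg] yy' y'u y'u'; have [xu _ _] := cell_bounds cu.
have [u0|/y'u' {}y'u'] := eqVneq u +oo%E.
  by have -> : y' = y by apply/eqP; rewrite eq_le yy' (le_trans _ y'u) // u0 leey.
have y0 : y != +oo%E by apply/eqP => /yoo u0; move: y'u'; rewrite u0 ltNge leey.
case: y yy' y0 reg cu yoo => [y| |] // yy' _ reg cu yoo; last first.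
  by move: (lt_le_trans y'u' yy'); rewrite ltNge leNye.
case: y' yy' y'u y'u' => [y'| |] // yy' y'u y'u'; last first.
  by move: y'u'; rewrite ltNge leNye.
apply: regular_segment; first by rewrite -lee_fin.
move=> t /andP[yt ty]; have tu : (u < t%:E)%E by apply: lt_le_trans y'u' _; rewrite lee_fin.
apply: reg; last 1 first.
- by move=> tE; move: tu; rewrite tE ltxx.
- exact: le_trans xu (ltW tu).
- by rewrite lee_fin.
Qed.

(** Intersect the windows with an optimal pair of neighbourhoods: shrinking a window towards [u] or
    [v] crosses only regular values and leaves the box unchanged, while the box of the optimal pair
    is at least that of the intersection by [box_mono]. *)
Lemma multiplicityE u v x y z w :
  (u < v)%E -> isolated x y u -> isolated z w v -> (y <= z)%E ->
  multiplicity p F u v = box (pdiag_ext p F) x y z w.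
Proof.
move=> uv iu iv yz; have [cu _ _ _] := iu; have [cv _ _ _] := iv.
have [mset mmin] := multiplicityP uv cu cv yz.
apply/eqP; rewrite eq_le multiplicity_le_box //=.
case: mset => Iu [Iv [[nu cu'] [nv cv'] dis ->]].
have [/andP[h1 h2] /andP[h3 h4] h5] := connected_nbhs_bounds uv nu cu' nv cv' dis.
have inf_u := nbhs_inf_lt nu; have sup_u := nbhs_sup_gt nu.
have inf_v := nbhs_inf_lt nv; have sup_v := nbhs_sup_gt nv.
move: (ereal_inf Iu) (ereal_sup Iu) (ereal_inf Iv) (ereal_sup Iv) h1 h2 h3 h4 h5
  inf_u sup_u inf_v sup_v => i j k l iu' uj kv vl jk inf_u sup_u inf_v sup_v.
have [xu uy _] := cell_bounds cu; have [zv vw _] := cell_bounds cv.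
pose x' := maxe x i; pose y' := mine y j; pose z' := maxe z k; pose w' := mine w l.
have strict_l (a b c d : \bar R) (ab : cell a b c) :
    (c != -oo -> d < c)%E -> (c != -oo -> maxe a d < c)%E.
  by move=> dc c0; rewrite gt_max dc // andbT; case: ab => [[//|[c1]]]; rewrite c1 in c0.
have strict_r (a b c d : \bar R) (ab : cell a b c) :
    (c != +oo -> c < d)%E -> (c != +oo -> c < mine b d)%E.
  by move=> dc c0; rewrite lt_min dc // andbT; case: ab => [_ [//|[c1]]]; rewrite c1 in c0.
have xx' : (x <= x')%E by rewrite le_max lexx.
have ix' : (i <= x')%E by rewrite le_max lexx orbT.
have x'u : (x' <= u)%E by rewrite ge_max xu.
have y'y : (y' <= y)%E by rewrite ge_min lexx.
have y'j : (y' <= j)%E by rewrite ge_min lexx orbT.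
have uy' : (u <= y')%E by rewrite le_min uy.
have zz' : (z <= z')%E by rewrite le_max lexx.
have kz' : (k <= z')%E by rewrite le_max lexx orbT.
have z'v : (z' <= v)%E by rewrite ge_max zv.
have w'w : (w' <= w)%E by rewrite ge_min lexx.
have w'l : (w' <= l)%E by rewrite ge_min lexx orbT.
have vw' : (v <= w')%E by rewrite le_min vw.
have [x1 _] := isolated_left iu xx' x'u (strict_l _ _ _ _ cu inf_u).
have [y1 _] := isolated_right iu y'y uy' (strict_r _ _ _ _ cu sup_u).
have [_ z2] := isolated_left iv zz' z'v (strict_l _ _ _ _ cv inf_v).
have [_ w2] := isolated_right iv w'w vw' (strict_r _ _ _ _ cv sup_v).
have yz' : (y <= z')%E := le_trans yz zz'.
have z'w' := le_trans z'v vw'; have yw' := le_trans yz' z'w'.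
have xy := le_trans xu uy.
have e1 : pdiag_ext p F y' z' = pdiag_ext p F y z by rewrite y1 // -z2.
have e2 : pdiag_ext p F x' z' = pdiag_ext p F x z.
  by rewrite -x1 ?(le_trans x'u) ?(le_trans uy) // -z2 // (le_trans xy).
have e3 : pdiag_ext p F y' w' = pdiag_ext p F y w by rewrite y1 // w2.
have e4 : pdiag_ext p F x' w' = pdiag_ext p F x w.
  by rewrite -x1 ?(le_trans x'u) ?(le_trans uy) // w2 // (le_trans xy).
have -> : box (pdiag_ext p F) x y z w = box (pdiag_ext p F) x' y' z' w'.
  by rewrite /box e1 e2 e3 e4.
have tr (a b c : \bar R) : (a <= b)%E -> (b <= c)%E -> (a <= c)%E by exact: le_trans.
exact: (box_mono tr pdiag_ext_rank ix' (tr _ _ _ x'u uy') y'j jk kz' z'w' w'l).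
Qed.

Lemma regular_value_near (t : R) : regular_value p F t ->
  \forall s \near t, regular_value p F s.
Proof.
move=> [I [nI cI kI]]; have := nbhs_interior nI; apply: filterS => s Is.
by exists I.
Qed.

Lemma regular_value_ball (t : R) : regular_value p F t ->
  exists2 e : R, 0 < e & forall s, `|t - s| <= e -> regular_value p F s.
Proof.
move=> /regular_value_near/nbhs_ballP[e /= e0 eI]; exists (e / 2); first lra.
by move=> s ts; apply: eI; rewrite /ball /=; lra.
Qed.

(** Shrink the window around [t] to regular values: the first side of the rectangle then crosses
    nothing critical, and its box vanishes. *)
Lemma regular_not_birth (t : R) v :
  regular_value p F t -> (t%:E < v)%E -> multiplicity p F t%:E v <= 0.
Proof.
move=> rt tv; have [e e0 eP] := regular_value_ball rt.
have [s [ts sv]] := ereal_between tv; rewrite lte_fin in ts.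
pose y := Num.min (t + e) s.
have ty : t < y by rewrite lt_min ts ltrDl e0.
have yv : (y%:E < v)%E by apply: le_lt_trans sv; rewrite lee_fin ge_min lexx orbT.
have ye : y <= t + e by rewrite ge_min lexx.
have xy : t - e <= y by lra.
have reg r : t - e <= r <= y -> regular_value p F r.
  by move=> /andP[tr ry]; apply: eP; rewrite ler_norml; lra.
have [k _] := regular_segment xy reg.
have cu : cell (t - e)%:E y%:E t%:E by apply/cell_fin; rewrite !lte_fin gtrBl.
have cv : cell y%:E +oo%E v.
  split; first by left.
  by case: v tv yv {sv} => [v| |] // ? ?; [left; exact: ltry | right].
apply: le_trans (multiplicity_le_box tv cu cv (lexx _)) _.
by rewrite /box (k y%:E) ?lexx // (k +oo%E) ?leey // subrr sub0r addNr.
Qed.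

Lemma regular_not_death (t : R) u :
  regular_value p F t -> (u < t%:E)%E -> multiplicity p F u t%:E <= 0.
Proof.
move=> rt ut; have [e e0 eP] := regular_value_ball rt.
have [s [us st]] := ereal_between ut; rewrite lte_fin in st.
pose x := Num.max (t - e) s.
have xt : x < t by rewrite gt_max st andbT gtrBl.
have ux : (u < x%:E)%E by apply: lt_le_trans us _; rewrite lee_fin le_max lexx orbT.
have xe : t - e <= x by rewrite le_max lexx.
have xy : x <= t + e by lra.
have reg r : x <= r <= t + e -> regular_value p F r.
  by move=> /andP[xr rt']; apply: eP; rewrite ler_norml; lra.
have [_ k] := regular_segment xy reg.
have cv : cell x%:E (t + e)%:E t%:E by apply/cell_fin; rewrite !lte_fin ltrDl.
have cu : cell -oo%E x%:E u.
  split; last by left.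
  by case: u ut ux {us} => [u| |] // ? ?; [left; exact: ltNyr | right].
apply: le_trans (multiplicity_le_box ut cu cv (lexx _)) _.
by rewrite /box (k x%:E) ?lexx // (k -oo%E) ?leNye // addrAC subrK subrr.
Qed.

Lemma cornerpoint_critical u v : cornerpoint p F (u, v) ->
  (u = -oo%E \/ exists2 t : R, critical_value p F t & u = t%:E) /\
  (v = +oo%E \/ exists2 t : R, critical_value p F t & v = t%:E).
Proof.
move=> [/= uv mu]; split.
- case: u uv mu => [t| |] uv mu; [right|by move: uv; rewrite ltNge leey|by left].
  by exists t => // rt; have := regular_not_birth rt uv; rewrite leNgt mu.
- case: v uv mu => [t| |] uv mu; [right|by left|by move: uv; rewrite ltNge leNye].
  by exists t => // rt; have := regular_not_death rt uv; rewrite leNgt mu.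
Qed.

End Multiplicity.

(** * Bijections of multisets *)

Section MultisetBijections.

Lemma count_mem_take_lt (T : eqType) (q0 : T) (L : seq T) (i j : nat) :
  (i < j <= size L)%N ->
  (count_mem (nth q0 L i) (take i L) < count_mem (nth q0 L i) (take j L))%N.
Proof.
elim: L i j => [|a L IH] [|i] [|j] //=; try lia.
  by rewrite eqxx.
by move=> ij; rewrite ltn_add2l; apply: IH.
Qed.

Lemma nth_count_mem (T : eqType) (q0 q : T) (L : seq T) (k : nat) :
  (k < count_mem q L)%N ->
  exists i, [/\ (i < size L)%N, nth q0 L i = q & count_mem q (take i L) = k].
Proof.
elim: L k => [//|a L IH] k /=; case: (eqVneq a q) => [->|aq] /=.
  case: k => [_|k]; first by exists 0%N.
  rewrite add1n ltnS => /IH[i [iL iq ik]].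
  by exists i.+1; split=> //=; rewrite eqxx ik.
rewrite add0n => /IH[i [iL iq ik]].
by exists i.+1; split=> //=; rewrite (negbTE aq).
Qed.

Variables (X : Type) (T : eqType) (diag : X -> T).
Hypothesis diag_inj : injective diag.

(** Occurrences of a diagonal point in [L] add nothing to [A], since such a point already carries
    every label. *)
Definition multiset_of (L : seq T) (A : set (T * nat)) : Prop :=
  forall q k, A (q, k) <-> (k < count_mem q L)%N \/ exists x, q = diag x.

Definition slots (n : nat) : set (nat + X * nat) :=
  [set z | match z with inl i => (i < n)%N | inr _ => True end].

(* The listed copies of a diagonal point carry its smallest labels, which shifts the
   labels of its remaining copies. *)
Definition slot_point (q0 : T) (L : seq T) (z : nat + X * nat) : T * nat :=
  match z with
  | inl i => (nth q0 L i, count_mem (nth q0 L i) (take i L))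
  | inr (x, k) => (diag x, count_mem (diag x) L + k)%N
  end.

(** Position [i] is labelled by the number of earlier occurrences of its entry, so equal entries
    receive consecutive labels from [0]. *)
Lemma slot_point_bij (q0 : T) (L : seq T) (A : set (T * nat)) :
  multiset_of L A -> set_bij (slots (size L)) A (slot_point q0 L).
Proof.
move=> LA.
have take_lt i : (i < size L)%N ->
    (count_mem (nth q0 L i) (take i L) < count_mem (nth q0 L i) L)%N.
  by move=> iL; rewrite -{4}(take_size L); apply: count_mem_take_lt; rewrite iL leqnn.
split.
- move=> [i|[x k]] /=; first by move=> iL; apply/LA; left; exact: take_lt.
  by move=> _; apply/LA; right; exists x.
- have lt_neq i j : (i < j)%N -> (j < size L)%N -> nth q0 L i = nth q0 L j ->
      count_mem (nth q0 L i) (take i L) = count_mem (nth q0 L j) (take j L) -> False.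
    move=> ij jL ijE; rewrite -ijE => cE.
    have := @count_mem_take_lt _ q0 L i j; rewrite ij (ltnW jL) cE ltnn.
    by move/(_ isT).
  move=> [i|[x k]] [j|[y l]]; rewrite !inE /= => Hi Hj [].
  + move=> e1 e2; congr inl; case: (ltngtP i j) => // ij.
      by case: (lt_neq _ _ ij Hj e1 e2).
    by case: (lt_neq _ _ ij Hi (esym e1) (esym e2)).
  + by move=> e1 e2; have := take_lt i Hi; rewrite e2 e1; lia.
  + by move=> e1 e2; have := take_lt j Hj; rewrite -e2 -e1; lia.
  + by move=> /diag_inj -> e2; congr (inr (_, _)); lia.
- move=> [q k] /LA Aqk; have [kq|kq] := ltnP k (count_mem q L).
    have [i [iL iq ik]] := nth_count_mem q0 kq.
    by exists (inl i) => //=; rewrite iq ik.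
  case: Aqk => [|[x qx]]; first by rewrite ltnNge kq.
  exists (inr (x, k - count_mem q L)%N) => //=.
  by rewrite -qx subnKC.
Qed.

(** Both sets are enumerated by the same slots: list positions are paired through [L], and each
    remaining diagonal copy goes to a copy of the same point. *)
Lemma multiset_bij (L : seq (T * T)) (A B : set (T * nat)) :
  multiset_of (unzip1 L) A -> multiset_of (unzip2 L) B ->
  exists2 beta, set_bij A B beta &
    forall q, A q -> (q.1, (beta q).1) \in L \/ (exists x, q.1 = diag x) /\ q.1 = (beta q).1.
Proof.
(* [nth] needs default entries, which an empty list does not supply; both sets then consist of the
   diagonal alone. *)
have [->|] := eqVneq L [::].
  move=> LA LB; exists id; last by move=> [q k] /LA[//|dq]; right.
  have -> : B = A by apply/seteqP; split=> -[q k]; rewrite LA LB.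
  by split => // z Az; exists z.
case: L => [//|[a0 b0] L0] _; move: (_ :: L0) => L.
move=> /(slot_point_bij a0)[fA iA sA] /(slot_point_bij b0)[fB iB sB].
rewrite !size_map in fA iA sA fB iB sB.
set f := slot_point a0 _ in fA iA sA; set g := slot_point b0 _ in fB iB sB.
have /choice[inv invP] q : exists z, A q -> slots (size L) z /\ f z = q.
  have [/sA[z Zz zq]|nAq] := pselect (A q); first by exists z.
  by exists (inl 0%N).
exists (fun q => g (inv q)).
  split.
  - by move=> q /invP[Zq _]; exact: fB.
  - move=> q q'; rewrite !inE => Aq Aq' gE.
    have [Zq fq] := invP q Aq; have [Zq' fq'] := invP q' Aq'.
    by rewrite -fq -fq' (iB (inv q) (inv q')) ?inE.
  - move=> b /sB[z Zz zb]; exists (f z); first exact: fA.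
    have [Zi fi] := invP (f z) (fA z Zz).
    by rewrite -zb; congr g; apply: iA; rewrite ?inE.
move=> q /invP[]; case: (inv q) => [i|[x k]] /= iL <- /=; last by right; split=> //; exists x.
left; rewrite (nth_map (a0, b0)) // (nth_map (a0, b0)) //.
by case: (nth _ L i) (mem_nth (a0, b0) iL).
Qed.

End MultisetBijections.

(** * Sampling on a grid *)

Section GridDiagram.
Variables (R : realType) (C : category) (p : forall a b : C, mor a b -> int).
Hypothesis hp : persistence_function p.
Variable F : functor (real_poset R) C.
Variables (g s : R) (n m : nat).
Hypothesis s_gt0 : 0 < s.

Definition grid (i : nat) : R := g + s * i%:R.

Hypothesis crit_window : forall c, critical_value p F c -> grid m.+1 < c < grid (n - m).
Hypothesis crit_off_grid : forall c i, critical_value p F c -> (i <= n)%N -> grid i <> c.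
Hypothesis crit_sep : forall c c', critical_value p F c -> critical_value p F c' ->
  `|c - c'| < s -> c = c'.
Hypothesis mn : (m.*2 < n)%N.

Lemma grid_lt (i j : nat) : (grid i < grid j) = (i < j)%N.
Proof. by rewrite /grid ltrD2l ltr_pM2l // ltr_nat. Qed.

Lemma grid_le_mono (i j : nat) : (grid i <= grid j) = (i <= j)%N.
Proof. by rewrite /grid lerD2l ler_pM2l // ler_nat. Qed.

Lemma gridS (i : nat) : grid i.+1 = grid i + s.
Proof. by rewrite /grid -natr1; ring. Qed.

(** The infinite values sit exactly at the indices that [sentinel_rank] treats as sentinels at
    length [n.+1]. *)
Definition ext_grid (i : nat) : \bar R :=
  if i == 0%N then -oo%E else if (n < i)%N then +oo%E else (grid i)%:E.

Lemma ext_grid_mono (i j : nat) : (i <= j)%N -> (ext_grid i <= ext_grid j)%E.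
Proof.
rewrite /ext_grid => ij; case: (posnP i) => [_|i0]; first exact: leNye.
have -> : (j == 0%N) = false by lia.
case: (ltnP n j) => nj; first exact: leey.
by rewrite ltnNge (leq_trans ij nj) /= lee_fin grid_le_mono.
Qed.

Lemma ext_gridE (i : nat) : (0 < i <= n)%N -> ext_grid i = (grid i)%:E.
Proof. by case/andP=> i0 iN; rewrite /ext_grid gtn_eqF // ltnNge iN. Qed.

(* The critical value in the [i]-th cell of the extended grid, or any point of that
   cell if there is none; the two unbounded cells get the infinite values. *)
Definition cell_point (i : nat) : \bar R :=
  if (i <= 1)%N then -oo%E else if (n < i)%N then +oo%E else
  (xget (grid i - s / 2) [set c | critical_value p F c /\ grid i.-1 < c < grid i])%:E.

Lemma cell_point_fin (i : nat) : (1 < i <= n)%N ->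
  exists2 c : R, cell_point i = c%:E & grid i.-1 < c < grid i.
Proof.
case/andP=> i1 iN; rewrite /cell_point leqNgt i1 ltnNge iN /=.
case: xgetP => [c _ [_ ci]|_]; first by exists c.
exists (grid i - s / 2) => //; case: i i1 iN => // i _ _.
by rewrite gridS /=; move: (grid i) s_gt0 => t s0; lra.
Qed.

Lemma cell_point_crit (i : nat) (c : R) :
  critical_value p F c -> (0 < i <= n.+1)%N ->
  (ext_grid i.-1 <= c%:E)%E -> (c%:E <= ext_grid i)%E -> cell_point i = c%:E.
Proof.
move=> cc; have /andP[c1 c2] := crit_window cc.
have {}c1 : grid 1 < c by apply: le_lt_trans c1; rewrite grid_le_mono.
have {}c2 : c < grid n by apply: lt_le_trans c2 _; rewrite grid_le_mono leq_subr.
move=> /andP[i0 iN] lo hi.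
have i1 : (1 < i)%N.
  rewrite ltnNge; apply/negP => i1; have iE : i = 1%N by lia.
  by move: hi; rewrite iE ext_gridE; [rewrite lee_fin leNgt c1 | lia].
have {}iN : (i <= n)%N.
  rewrite leqNgt; apply/negP => ni; have iE : i = n.+1 by lia.
  by move: lo; rewrite iE ext_gridE; [rewrite lee_fin leNgt c2 | lia].
move: lo hi; rewrite !ext_gridE; try lia; rewrite !lee_fin => lo hi.
rewrite /cell_point leqNgt i1 ltnNge iN /=; congr EFin.
have lo' : grid i.-1 < c.
  by rewrite lt_neqAle lo andbT; apply/eqP; apply: crit_off_grid => //; lia.
have hi' : c < grid i.
  by rewrite lt_neqAle hi andbT; apply/eqP => /esym; apply: crit_off_grid.
case: xgetP => [c' _ [cc' c'i]|/(_ c)[]]; last first.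
  by split=> //; rewrite lo' hi'.
apply: crit_sep => //.
have gE : grid i = grid i.-1 + s by rewrite -gridS prednK.
have ci : grid i.-1 < c < grid i by rewrite lo' hi'.
move: c'i ci; rewrite gE; move: (grid i.-1) s_gt0 => t s0 c'i ci; rewrite ltr_distl; lra.
Qed.

(** Grid points are never critical and distinct critical values are at least [s] apart, so a closed
    bounded cell contains at most one, which [cell_point] picks. By [crit_window] the unbounded
    cells contain none. *)
Lemma cell_point_isolated (i : nat) : (0 < i <= n.+1)%N ->
  isolated p F (ext_grid i.-1) (ext_grid i) (cell_point i).
Proof.
move=> iN; split.
- have [i1|i1] := leqP i 1.
    have -> : i = 1%N by lia.
    rewrite /cell_point /= /ext_grid /=; split; [by right|left].
    by case: ifP => _; [|exact: ltNyr].
  have [ni|ni] := ltnP n i.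
    have -> : i = n.+1 by lia.
    rewrite /cell_point ltnSn (_ : (n.+1 <= 1)%N = false) /=; last lia.
    split; [left|right].
      by rewrite ext_gridE ?ltry //; lia.
    by rewrite /ext_grid ltnSn.
  have [|c -> /andP[c1 c2]] := @cell_point_fin i; first lia.
  rewrite !ext_gridE; try lia.
  by apply/cell_fin; rewrite !lte_fin.
- rewrite /ext_grid; case: eqP => [i1 _|_].
    by rewrite /cell_point; have -> : (i <= 1)%N by lia.
  by case: ifP.
- rewrite /ext_grid; case: eqP => // _; case: ifP => // ni _.
  by rewrite /cell_point ni; have -> : (i <= 1)%N = false by lia.
- move=> t lo hi tc; apply: contrapT => ct; apply: tc.
  by rewrite (cell_point_crit ct iN lo hi).
Qed.

Lemma cell_point_lt (i j : nat) : (0 < i)%N -> (i < j <= n.+1)%N ->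
  (cell_point i < cell_point j)%E.
Proof.
move=> i0 /andP[ij jN].
have [ci _ _ _] := @cell_point_isolated i ltac:(lia).
have [cj _ _ _] := @cell_point_isolated j ltac:(lia).
have [xj _ _] := cell_bounds cj.
have lt : (cell_point i < ext_grid i)%E.
  by case: ci => [_ [//|[_]]]; rewrite ext_gridE //; lia.
by apply: lt_le_trans lt (le_trans _ xj); apply: ext_grid_mono; lia.
Qed.

Lemma cell_point_inj (i j : nat) : (0 < i <= n.+1)%N -> (0 < j <= n.+1)%N ->
  cell_point i = cell_point j -> i = j.
Proof.
move=> iN jN ijE; case: (ltngtP i j) => // ij.
- by have := @cell_point_lt i j ltac:(lia) ltac:(lia); rewrite ijE ltxx.
- by have := @cell_point_lt j i ltac:(lia) ltac:(lia); rewrite ijE ltxx.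
Qed.

Lemma critical_cell (c : R) : critical_value p F c ->
  exists2 i : nat, (1 < i <= n)%N & cell_point i = c%:E.
Proof.
move=> cc; have /andP[c1 c2] := crit_window cc.
have {}c1 : grid 1 < c by apply: le_lt_trans c1; rewrite grid_le_mono.
have {}c2 : c < grid n by apply: lt_le_trans c2 _; rewrite grid_le_mono leq_subr.
have ex : exists i, c < grid i by exists n.
case: (ex_minnP ex) => i ci imin.
have iN : (i <= n)%N by exact: imin.
have i1 : (1 < i)%N by rewrite -grid_lt; exact: lt_trans ci.
exists i; first by rewrite i1.
apply: cell_point_crit => //; rewrite ?ext_gridE ?lee_fin ?(ltW ci) //; try lia.
by rewrite leNgt; apply/negP => /imin; lia.
Qed.

Lemma cornerpoint_cells (u v : \bar R) : cornerpoint p F (u, v) ->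
  exists i j, [/\ (0 < i)%N, (i < j <= n.+1)%N, u = cell_point i & v = cell_point j].
Proof.
move=> cuv; have [uv _] := cuv; have [cu cv] := cornerpoint_critical hp cuv.
have [i [iN ui]] : exists i, (0 < i <= n)%N /\ u = cell_point i.
  case: cu => [->|[c /critical_cell[i iN ci] ->]]; last by exists i; split=> //; lia.
  by exists 1%N; split; [lia | rewrite /cell_point].
have [j [jN vj]] : exists j, (1 < j <= n.+1)%N /\ v = cell_point j.
  case: cv => [->|[c /critical_cell[j jN cj] ->]]; last by exists j; split=> //; lia.
  exists n.+1; split; first lia.
  by rewrite /cell_point ltnSn; have -> : (n.+1 <= 1)%N = false by lia.
exists i, j; split=> //; first lia.
case: (ltnP i j) => [ij|ji]; first lia.
move: uv; rewrite /= ui vj.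
have [->|ij] := eqVneq i j; first by rewrite ltxx.
by rewrite ltNge ltW // cell_point_lt //; lia.
Qed.

Definition grid_chain := sentinel_rank n.+1 (pdiag_min p F)
  (fun i j => pdiag_ext p F (grid i)%:E (grid j)%:E).

Lemma grid_chainE (i j : nat) : (i <= j)%N -> grid_chain i j =
  pdiag_ext p F (ext_grid i) (ext_grid j).
Proof.
move=> ij; rewrite /grid_chain /sentinel_rank /ext_grid.
case: (posnP i) => [//|i0]; have -> : (j == 0%N) = false by lia.
by case: (ltnP n j) => nj; [case: ifP|rewrite ltnNge (leq_trans ij nj)].
Qed.

(** The corners of the second difference are the ends of two isolating windows, so a single grid
    already reads off the exact multiplicities. *)
Lemma chain_mult_multiplicity (i j : nat) : (i < j <= n)%N ->
  chain_mult grid_chain i j = multiplicity p F (cell_point i.+1) (cell_point j.+1).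
Proof.
move=> /andP[ij jn].
rewrite (multiplicityE hp (x := ext_grid i) (y := ext_grid i.+1) (z := ext_grid j)
  (w := ext_grid j.+1)).
- by rewrite /chain_mult /box !grid_chainE //; lia.
- by apply: cell_point_lt => //; lia.
- by apply: (@cell_point_isolated i.+1); lia.
- by apply: (@cell_point_isolated j.+1); lia.
- exact: ext_grid_mono.
Qed.

(** A merged pair goes to the diagonal at its grid point, which obeys the same bounds
    [grid i - s <= x <= grid i] as a finite [cell_point]. *)
Definition cell_pair (q : nat * nat) : \bar R * \bar R :=
  if (q.1 < q.2)%N then (cell_point q.1, cell_point q.2) else ((grid q.1)%:E, (grid q.1)%:E).

Lemma count_cell_pair (L : seq (nat * nat)) (i j : nat) :
  represents n.+1 (pdiag_min p F) grid_chain L -> (0 < i)%N -> (i < j <= n.+1)%N ->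
  (count_mem (cell_point i, cell_point j) (map cell_pair L))%:Z =
  multiplicity p F (cell_point i) (cell_point j).
Proof.
move=> rL i0 ijN; have := represents_count (a := i.-1) (b := j.-1) _ rL.
rewrite chain_mult_multiplicity ?prednK; try lia.
move=> <-; last lia.
congr Posz; rewrite count_map; apply: eq_in_count => -[a b] /(allP rL.1) /=.
rewrite /in_range /cell_pair /= => ab.
have uv : (cell_point i < cell_point j)%E by apply: cell_point_lt.
case: ltnP => abl; last first.
  rewrite !xpair_eqE; apply/andP/andP => -[/eqP e1 /eqP e2].
    by move: uv; rewrite -e1 -e2 ltxx.
  by lia.
rewrite !xpair_eqE; apply/andP/andP => -[/eqP e1 /eqP e2]; last by rewrite e1 e2.
have [aN bN] : (0 < a <= n.+1)%N /\ (0 < b <= n.+1)%N by lia.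
have [iN jN] : (0 < i <= n.+1)%N /\ (0 < j <= n.+1)%N by lia.
by split; apply/eqP; [exact: cell_point_inj e1 | exact: cell_point_inj e2].
Qed.

Lemma cell_pair_diagram (L : seq (nat * nat)) :
  represents n.+1 (pdiag_min p F) grid_chain L ->
  multiset_of (fun x : R => (x%:E, x%:E)) (map cell_pair L) (persistence_diagram p F).
Proof.
move=> rL [u v] k; split.
- move=> [[/= cuv kuv]|[x /= ->]]; last by right; exists x.
  have [i [j [i0 ij uE vE]]] := cornerpoint_cells cuv.
  by left; rewrite -ltz_nat uE vE count_cell_pair // -uE -vE.
- move=> [kL|[x ->]]; last by right; exists x.
  have : (u, v) \in map cell_pair L by rewrite -has_pred1 has_count; lia.
  case/mapP => -[a b] /(allP rL.1) /=; rewrite /in_range /cell_pair /= => ab.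
  case: ltnP => abl [ua va]; last by right; exists (grid a); rewrite /= ua va.
  left; have abN : (a < b <= n.+1)%N by lia.
  move: kL; rewrite ua va -ltz_nat count_cell_pair //=; last lia.
  move=> kL; split => //; split=> /=; last exact: le_lt_trans kL.
  by apply: cell_point_lt => //; lia.
Qed.

(** Points listed off the diagonal are cornerpoints, so their finite coordinates are critical and
    respect the margins of [m] cells. *)
Lemma cell_pair_critical (L : seq (nat * nat)) (a b : nat) :
  represents n.+1 (pdiag_min p F) grid_chain L -> (a, b) \in L -> (a < b)%N ->
  (a = 1%N \/ [/\ (m.+1 < a)%N, (a <= n - m)%N &
     exists2 c : R, cell_point a = c%:E & grid a.-1 < c < grid a]) /\
  (b = n.+1 \/ [/\ (m.+1 < b)%N, (b <= n - m)%N &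
     exists2 c : R, cell_point b = c%:E & grid b.-1 < c < grid b]).
Proof.
move=> rL abL ab; have := allP rL.1 _ abL; rewrite /in_range /= => abN.
have cab : cornerpoint p F (cell_point a, cell_point b).
  split; first by apply: cell_point_lt => //; lia.
  rewrite /= -(count_cell_pair rL); try lia.
  rewrite ltz_nat -has_count has_pred1; apply/mapP; exists (a, b) => //.
  by rewrite /cell_pair /= ab.
have crit i c : cell_point i = c%:E -> critical_value p F c -> (0 < i <= n.+1)%N ->
    [/\ (m.+1 < i)%N, (i <= n - m)%N &
     exists2 c : R, cell_point i = c%:E & grid i.-1 < c < grid i].
  move=> ic cc iN; have i1 : (1 < i)%N.
    by rewrite ltnNge; apply/negP => i1; move: ic; rewrite /cell_point i1.
  have {}iN : (i <= n)%N.
    rewrite leqNgt; apply/negP => ni; move: ic; rewrite /cell_point ni.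
    by rewrite leqNgt i1.
  have [|c' ic' /andP[lo hi]] := @cell_point_fin i; first by rewrite i1.
  have /andP[c1 c2] := crit_window cc.
  have cc' : c = c' by move: ic; rewrite ic' => -[].
  split.
  - by rewrite -grid_lt; apply: lt_trans c1 _; rewrite cc'.
  - have : grid i.-1 < grid (n - m) by apply: lt_trans c2; rewrite cc'.
    by rewrite grid_lt; lia.
  - by exists c' => //; rewrite lo.
have [ca cb] := cornerpoint_critical hp cab; split.
- case: ca => [aoo|[c cc ac]]; last by right; apply: (crit a c) => //; lia.
  left; move: aoo; rewrite /cell_point; case: (leqP a 1) => [a1 _|_]; first lia.
  by case: ifP.
- case: cb => [boo|[c cc bc]]; last by right; apply: (crit b c) => //; lia.
  left; move: boo; rewrite /cell_point; case: (leqP b 1) => // b1.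
  by case: (ltnP n b) => // nb _; lia.
Qed.

End GridDiagram.

Lemma represents_ext (N : nat) (base : int) (r r' : nat -> nat -> int) (L : seq (nat * nat)) :
  (forall x y, (x <= y <= N)%N -> r x y = r' x y) ->
  represents N base r L -> represents N base r' L.
Proof. by move=> rr' [Lr Lc]; split=> // x y xy; rewrite Lc // rr'. Qed.

(** * Stability for two adapted grids *)

Section GridStability.
Variables (R : realType) (C : category) (hC : has_finite_colimits C).
Variables (p : forall a b : C, mor a b -> int) (hp : persistence_function p).

Definition adapted_grid (F : functor (real_poset R) C) (g s : R) (n m : nat) : Prop :=
  [/\ forall c, critical_value p F c -> grid g s m.+1 < c < grid g s (n - m),
      forall c i, critical_value p F c -> (i <= n)%N -> grid g s i <> c
    & forall c c', critical_value p F c -> critical_value p F c' -> `|c - c'| < s -> c = c'].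

Lemma coord_distxx (x : \bar R) : coord_dist x x = 0%E.
Proof. by rewrite /coord_dist eqxx. Qed.

Lemma coord_dist_le (x y D : R) : `|x - y| <= D -> (coord_dist x%:E y%:E <= D%:E)%E.
Proof.
move=> xyD; rewrite /coord_dist; case: eqP => _; rewrite lee_fin //.
exact: le_trans xyD.
Qed.

Variables (F1 F2 : functor (real_poset R) C) (g s d : R) (n E : nat).
Hypothesis s_gt0 : 0 < s.
Hypothesis E_gt0 : (0 < E)%N.
Hypothesis dE : d = s * E%:R.
Hypothesis En : (6 * E < n)%N.
Hypothesis grid1 : adapted_grid F1 g s n (3 * E).
Hypothesis grid2 : adapted_grid F2 (g + d) s n (3 * E).

Let r1 := grid_chain p F1 g s n.
Let r2 := grid_chain p F2 (g + d) s n.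
Let base := pdiag_min p F1.

Section Interleaved.
Variable e : R.
Hypotheses (F1F2 : interleaved e F1 F2) (ed : e <= d).

Lemma interleaved_matched :
  pdiag_min p F2 = base /\ matched n.+1 base E.*2 r1 r2.
Proof.
have [r [rP rl rr]] := interpolating_rank hC hp F1F2 ed.
have [rm1 rm2 _] := rP.
have [[x1 [y1 [xy1 m1E]]] m1] := pdiag_minP hp F1.
have [[x2 [y2 [xy2 m2E]]] m2] := pdiag_minP hp F2.
have d0 : 0 <= d by rewrite dE mulr_ge0 // ltW.
have grid_le_tr (z w v : R * R) : grid_le z w -> grid_le w v -> grid_le z v.
  by move=> /andP[zw1 zw2] /andP[wv1 wv2]; rewrite /grid_le (le_trans zw1) ?(le_trans zw2).
have sandwich (z z' w' w : R * R) : grid_le z z' -> grid_le z' w' -> grid_le w' w ->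
    r z w <= r z' w'.
  move=> zz' zw' ww'; apply: le_trans (rm2 _ _ _ zw' ww').
  by apply: rm1 => //; exact: grid_le_tr ww'.
(* Every pair in the plane is enclosed by a pair on the line of [F1], so the minimum of [F1] bounds
   all of [r]. The same holds for [F2], whence the two minima agree. *)
have low1 z w : grid_le z w -> base <= r z w.
  move=> zw; pose x := Num.min z.1 (z.2 + d); pose y := Num.max w.1 (w.2 + d).
  have zx : grid_le (x, x - d) z.
    by rewrite /grid_le /= lerBlDr !ge_min !lexx orbT.
  have wy : grid_le w (y, y - d).
    by rewrite /grid_le /= lerBrDr !le_max !lexx orbT.
  have xy : x <= y by have /andP[] := grid_le_tr _ _ _ zx (grid_le_tr _ _ _ zw wy).
  apply: le_trans (sandwich _ _ _ _ zx zw wy); rewrite (rl _ _ xy); exact: m1.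
have low2 z w : grid_le z w -> pdiag_min p F2 <= r z w.
  move=> zw; pose x := Num.min (z.1 + d) z.2; pose y := Num.max (w.1 + d) w.2.
  have zx : grid_le (x - d, x) z.
    by rewrite /grid_le /= lerBlDr !ge_min !lexx orbT.
  have wy : grid_le w (y - d, y).
    by rewrite /grid_le /= lerBrDr !le_max !lexx orbT.
  have xy : x <= y by have /andP[] := grid_le_tr _ _ _ zx (grid_le_tr _ _ _ zw wy).
  apply: le_trans (sandwich _ _ _ _ zx zw wy); rewrite (rr _ _ xy); exact: m2.
have bE : pdiag_min p F2 = base.
  apply/eqP; rewrite eq_le; apply/andP; split.
  - by rewrite /base m1E -(rl _ _ xy1); apply: low2; rewrite /grid_le /= lerD2r xy1.
  - by rewrite m2E -(rr _ _ xy2); apply: low1; rewrite /grid_le /= lerD2r xy2.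
split=> //.
(* For [c = 0] the chain runs on the line of [F1]. For [c = E.*2] its second coordinate is
   [g + d + s * i], which is why [F2] is sampled on the grid starting at [g + d]. *)
pose z c i : R * R := (g + s * i%:R, g + s * i%:R - d + s * c%:R).
have z_step c i : grid_le (z c i) (z c.+1 i).
  by rewrite /grid_le /= lexx /= lerD2l ler_pM2l // ler_nat.
have z_inter c i : grid_le (z c.+1 i) (z c i.+1).
  rewrite /grid_le /z /= -!natr1 !mulrDr !mulr1; move: s_gt0 => s0; apply/andP; split; lra.
have grid_le_rfl (w : R * R) : grid_le w w by rewrite /grid_le !lexx.
have [L [L1 L2 Ld]] := matched_chain n grid_le_rfl grid_le_tr rP low1 z_step z_inter E.*2.
exists L; split=> //.
- apply: represents_ext L1 => x y /andP[xy yn].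
  rewrite /r1 /grid_chain /sentinel_rank; case: ifP => // _.
  have gxy : grid g s x <= grid g s y by rewrite grid_le_mono.
  by rewrite (pdiag_extE p F1 gxy) -(rl _ _ gxy) /z mulr0 !addr0.
- apply: represents_ext L2 => x y /andP[xy yn].
  rewrite /r2 /grid_chain /sentinel_rank bE; case: ifP => // _.
  have gxy : grid (g + d) s x <= grid (g + d) s y by rewrite grid_le_mono.
  rewrite (pdiag_extE p F2 gxy) -(rr _ _ gxy) /z /grid; congr (r (_, _) (_, _));
    rewrite ?dE -?muln2 ?natrM; ring.
Qed.

Lemma drift_dist (a a' : nat) (x y : R) : (a' <= a <= a' + E.*2)%N ->
  grid g s a - s <= x <= grid g s a -> grid (g + d) s a' - s <= y <= grid (g + d) s a' ->
  (coord_dist x%:E y%:E <= (d + s)%:E)%E.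
Proof.
move=> /andP[a'a aa'] xa ya'; apply: coord_dist_le.
have h1 : s * a'%:R <= s * a%:R by rewrite ler_pM2l // ler_nat.
have h2 : s * a%:R <= s * a'%:R + d + d.
  have -> : s * a'%:R + d + d = s * (a' + E.*2)%:R.
    by rewrite dE -muln2 natrD natrM; ring.
  by rewrite ler_pM2l // ler_nat.
move: xa ya'; rewrite /grid ler_norml; lra.
Qed.

Lemma cell_pair_dist (L : seq ((nat * nat) * (nat * nat))) (x : (nat * nat) * (nat * nat)) :
  represents n.+1 base r1 (unzip1 L) -> represents n.+1 (pdiag_min p F2) r2 (unzip2 L) ->
  x \in L -> drift E.*2 x ->
  (point_dist (cell_pair p F1 g s n x.1) (cell_pair p F2 (g + d) s n x.2) <= (d + s)%:E)%E.
Proof.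
case: x => [[a b] [a' b']] L1 L2 xL /andP[/= da db].
have ab1 : (a, b) \in unzip1 L by apply/mapP; eexists; first exact: xL.
have ab2 : (a', b') \in unzip2 L by apply/mapP; eexists; first exact: xL.
have := allP L1.1 _ ab1; have := allP L2.1 _ ab2; rewrite /in_range /= => R2 R1.
have [w1 o1 s1] := grid1; have [w2 o2 s2] := grid2.
have E2n : ((3 * E).*2 < n)%N by lia.
have crit1 := cell_pair_critical hp s_gt0 w1 o1 s1 E2n L1 ab1.
have crit2 := cell_pair_critical hp s_gt0 w2 o2 s2 E2n L2 ab2.
have ds0 : (0 <= (d + s)%:E)%E.
  by rewrite lee_fin dE addr_ge0 ?mulr_ge0 // ltW.
have fin1 i : (1 < i <= n)%N -> exists2 t : R, cell_point p F1 g s n i = t%:E &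
    grid g s i - s <= t <= grid g s i.
  move=> iN; have [t tE ti] := cell_point_fin p F1 g s_gt0 iN.
  exists t => //; case: i iN ti {tE} => // i _; rewrite gridS /= addrK => /andP[/ltW -> /ltW ->] //.
have fin2 i : (1 < i <= n)%N -> exists2 t : R, cell_point p F2 (g + d) s n i = t%:E &
    grid (g + d) s i - s <= t <= grid (g + d) s i.
  move=> iN; have [t tE ti] := cell_point_fin p F2 (g + d) s_gt0 iN.
  exists t => //; case: i iN ti {tE} => // i _; rewrite gridS /= addrK => /andP[/ltW -> /ltW ->] //.
have dg1 i : grid g s i - s <= grid g s i <= grid g s i by rewrite gerBl ltW // lexx.
have dg2 i : grid (g + d) s i - s <= grid (g + d) s i <= grid (g + d) s i.
  by rewrite gerBl ltW // lexx.
(* If exactly one of the two pairs is merged, the indices of the other are at most [2 * E] apart, so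
   by the margins neither of its coordinates is infinite. *)
rewrite /cell_pair /=; case: (ltnP a b) => ab; case: (ltnP a' b') => ab';
  rewrite /point_dist ge_max /=; apply/andP.
- have [ca _] := crit1 ab; have [_ cb'] := crit2 ab'; split.
  + case: ca => [a1|[ma an _]].
      have a'1 : a' = 1%N by lia.
      by rewrite a1 a'1 /cell_point /= coord_distxx.
    have [|t -> ta] := fin1 a; first lia.
    have [|t' -> ta'] := fin2 a'; first lia.
    exact: drift_dist ta ta'.
  + case: cb' => [b'n|[mb bn _]].
      have bn : b = n.+1 by lia.
      have n1 : (n.+1 <= 1)%N = false by lia.
      by rewrite bn b'n /cell_point n1 ltnSn coord_distxx.
    have [|t -> tb] := fin1 b; first lia.
    have [|t' -> tb'] := fin2 b'; first lia.
    exact: drift_dist tb tb'.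
- have [ca cb] := crit1 ab.
  have a'b' : b' = a' by lia.
  have [a1 an] : (1 < a)%N /\ (a <= n)%N.
    by case: ca => [?|[? ? _]]; case: cb => [?|[? ? _]]; lia.
  have bn : (b <= n)%N by case: ca => [?|[? ? _]]; case: cb => [?|[? ? _]]; lia.
  split.
  + have [|t -> ta] := fin1 a; first lia.
    exact: drift_dist ta (dg2 _).
  + have [|t -> tb] := fin1 b; first lia.
    by apply: drift_dist tb (dg2 _); rewrite -a'b'.
- have [ca cb] := crit2 ab'.
  have bE : b = a by lia.
  have [a1 an] : (1 < a')%N /\ (a' <= n)%N.
    by case: ca => [?|[? ? _]]; case: cb => [?|[? ? _]]; lia.
  have bn : (b' <= n)%N by case: ca => [?|[? ? _]]; case: cb => [?|[? ? _]]; lia.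
  split.
  + have [|t -> ta] := fin2 a'; first lia.
    exact: drift_dist (dg1 _) ta.
  + have [|t -> tb] := fin2 b'; first lia.
    by apply: drift_dist (dg1 _) tb; rewrite -bE.
- have bE : b = a by lia.
  have bE' : b' = a' by lia.
  by split; apply: drift_dist (dg1 _) (dg2 _).
Qed.

Lemma grid_bottleneck :
  (bottleneck_dist (persistence_diagram p F1) (persistence_diagram p F2) <= (d + s)%:E)%E.
Proof.
have [bE [L [L1 L2 /allP Ld]]] := interleaved_matched.
rewrite -bE in L2.
have [w1 o1 s1] := grid1; have [w2 o2 s2] := grid2.
have E2n : ((3 * E).*2 < n)%N by lia.
have D1 := cell_pair_diagram hp s_gt0 w1 o1 s1 E2n L1.
have D2 := cell_pair_diagram hp s_gt0 w2 o2 s2 E2n L2.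
pose L' := [seq (cell_pair p F1 g s n x.1, cell_pair p F2 (g + d) s n x.2) | x <- L].
have L'1 : unzip1 L' = map (cell_pair p F1 g s n) (unzip1 L) by rewrite /unzip1 -!map_comp.
have L'2 : unzip2 L' = map (cell_pair p F2 (g + d) s n) (unzip2 L) by rewrite /unzip2 -!map_comp.
rewrite -L'1 in D1; rewrite -L'2 in D2.
have diag_inj : injective (fun x : R => (x%:E, x%:E)) by move=> x y [].
have [beta bij betaP] := multiset_bij diag_inj D1 D2.
apply: ge_ereal_inf; eexists; first by exists beta; [exact: bij | reflexivity].
apply: ge_ereal_sup => _ [q Aq <-].
case: (betaP q Aq) => [/mapP[x xL [-> ->]]|[_ ->]].
  exact: cell_pair_dist L1 L2 xL (Ld _ xL).
by rewrite /point_dist !coord_distxx maxxx lee_fin dE addr_ge0 ?mulr_ge0 // ltW.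
Qed.

End Interleaved.
End GridStability.

(** * Separating, bounding and avoiding finite sets of reals *)

Section FiniteSetsOfReals.
Variable R : realType.

Lemma finite_gap (A : seq R) :
  exists2 w : R, 0 < w & forall x y, x \in A -> y \in A -> `|x - y| < w -> x = y.
Proof.
suff iso (a : R) (B : seq R) :
    exists2 w : R, 0 < w & forall y, y \in B -> `|a - y| < w -> a = y.
  elim: A => [|a A [w w0 IH]]; first by exists 1.
  have [v v0 va] := iso a A; exists (Num.min w v); first by rewrite lt_min w0.
  move=> x y; rewrite !inE lt_min => /orP[/eqP -> |xA] /orP[/eqP -> |yA] /andP[xw xv] //.
  - exact: va.
  - by apply/esym/va => //; rewrite distrC.
  - exact: IH.
elim: B => [|b B [w w0 IH]]; first by exists 1.
have [ab|ab] := eqVneq a b.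
  by exists w => // y; rewrite inE => /orP[/eqP -> //|]; exact: IH.
exists (Num.min w `|a - b|); first by rewrite lt_min w0 normr_gt0 subr_eq0.
move=> y; rewrite inE lt_min => /orP[/eqP ->|yB] /andP[yw yb]; last exact: IH.
by rewrite ltxx in yb.
Qed.

Lemma finite_bounded (A : seq R) : exists2 M : R, 0 < M & forall x, x \in A -> `|x| < M.
Proof.
elim: A => [|a A [M M0 IH]]; first by exists 1.
exists (Num.max M (`|a| + 1)); first by rewrite lt_max M0.
by move=> x; rewrite inE lt_max => /orP[/eqP ->|/IH ->//]; rewrite ltrDl ltr01 orbT.
Qed.

Lemma finite_avoid (A : seq R) (y z : R) : y < z -> exists2 g : R, y < g < z & g \notin A.
Proof.
move=> yz; suff [z' /andP[yz' z'z] z'A] :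
    exists2 z', y < z' <= z & forall x, x \in A -> ~ (y < x < z').
  exists ((y + z') / 2); first lra.
  by apply/negP => /z'A; apply; lra.
elim: A => [|a A [w /andP[yw wz] IH]]; first by exists z => //; rewrite yz lexx.
have [ya|ya] := ltP y a.
  exists (Num.min a w); first by rewrite lt_min ya yw /= ge_min wz orbT.
  move=> x; rewrite inE lt_min => /orP[/eqP -> |/IH xA] /and3P[yx xa xw].
    by rewrite ltxx in xa.
  by apply: xA; rewrite yx.
exists w; first by rewrite yw.
move=> x; rewrite inE => /orP[/eqP -> |/IH //] /andP[yx _].
by move: (lt_le_trans yx ya); rewrite ltxx.
Qed.

End FiniteSetsOfReals.

Theorem theorem2 (R : realType) (C : category) (hC : has_finite_colimits C)
    (p : forall a b : C, mor a b -> int) (hp : persistence_function p)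
    (F1 F2 : functor (real_poset R) C) (tame1 : tame p F1) (tame2 : tame p F2) :
  (interleaving_dist F1 F2 >=
   bottleneck_dist (persistence_diagram p F1) (persistence_diagram p F2))%E.
Proof.
apply: le_ereal_inf_tmp => _ [e F1F2 <-]; apply/lee_addgt0Pr => eta eta0.
have e0 : 0 <= e by case: F1F2.
move/finite_seqP: tame1 => [C1 C1E]; move/finite_seqP: tame2 => [C2 C2E].
pose A := C1 ++ C2.
have A1 c : critical_value p F1 c -> c \in A.
  have /seteqP[+ _] := C1E; move=> /(_ c) h /h cC.
  by rewrite mem_cat cC.
have A2 c : critical_value p F2 c -> c \in A.
  have /seteqP[+ _] := C2E; move=> /(_ c) h /h cC.
  by rewrite mem_cat cC orbT.
have [w w0 gap] := finite_gap A; have [M M0 bnd] := finite_bounded A.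
(* Half of [eta] goes into [d] and the rest into [s], so that [d + s < e + eta]; the bound [u] also
   keeps [s] below the gap between critical values. *)
pose d := e + eta / 2; have d0 : 0 < d by rewrite /d; lra.
pose u := Num.min w (eta / 2); have u0 : 0 < u by rewrite lt_min w0 /=; lra.
have [E Egt0 Eu] : exists2 E : nat, (0 < E)%N & d / E%:R < u.
  exists (Num.bound (d / u)).+1 => //; rewrite ltr_pdivrMr ?ltr0n // mulrC -ltr_pdivrMr //.
  by apply: lt_trans (archi_boundP (ltW (divr_gt0 d0 u0))) _; rewrite ltr_nat.
have E0 : 0 < E%:R :> R by rewrite ltr0n.
have [s sE] : exists s, s = d / E%:R by exists (d / E%:R).
have s0 : 0 < s by rewrite sE divr_gt0.
rewrite -sE in Eu.
have dE : d = s * E%:R by rewrite sE divfK // gt_eqF.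
have sw : s < w by apply: lt_le_trans Eu _; rewrite ge_min lexx.
have seta : s < eta / 2 by apply: lt_le_trans Eu _; rewrite ge_min lexx orbT.
(* [4 * d + s] covers the [(3 * E).+1] steps of the lower margin and the offset [d] of the second
   grid; the constant leaves room to choose [g] between [y] and [y + 1]. *)
pose y := - M - 4 * d - s - 2.
have [n nP] : exists n : nat, M + 3 * d - y + 3 * d < s * n%:R.
  exists (Num.bound ((M + 3 * d - y + 3 * d) / s)).
  rewrite [s * _]mulrC -ltr_pdivrMr //; apply: archi_boundP.
  by rewrite divr_ge0 ?(ltW s0) // /y; lra.
have En : (6 * E < n)%N.
  rewrite -(ltr_nat R) -(ltr_pM2l s0); apply: lt_trans nP.
  by rewrite natrM mulrCA -dE /y; lra.
(* The second grid is the first one shifted by [E] indices, so avoiding critical values at all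
   indices up to [n + E] serves both. *)
have [g /andP[yg gy] gA] := @finite_avoid R [seq c - s * j%:R | c <- A, j <- iota 0 (n + E).+1]
  y (y + 1) ltac:(lra).
have gP c j : c \in A -> (j <= n + E)%N -> g + s * j%:R <> c.
  move=> cA jn gc; move/negP: gA; apply.
  apply/allpairsP; exists (c, j); split=> //; first by rewrite mem_iota ltnS.
  by rewrite -gc addrK.
have sub3 : s * (n - 3 * E)%:R = s * n%:R - 3 * d.
  rewrite natrB ?natrM; last by rewrite (leq_trans _ (ltnW En)) // leq_mul2r orbT.
  by rewrite mulrBr mulrCA -dE.
have S3 : s * (3 * E).+1%:R = 3 * d + s.
  by rewrite -natr1 natrM mulrDr mulr1 mulrCA -dE.
apply: (@le_trans _ _ (d + s)%:E); last by rewrite -EFinD lee_fin /d; lra.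
apply: (@grid_bottleneck R C hC p hp F1 F2 g s d n E s0 Egt0 dE En _ _ e F1F2).
- split.
  + move=> c /A1/bnd; rewrite /grid S3 sub3 ltr_norml /y in yg gy nP *; lra.
  + by move=> c i /A1 cA iN; apply: gP => //; exact: leq_trans iN (leq_addr _ _).
  + by move=> c c' /A1 cA /A1 cA' cc'; apply: gap => //; exact: lt_trans sw.
- split.
  + move=> c /A2/bnd; rewrite /grid S3 sub3 ltr_norml /y in yg gy nP *; lra.
  + move=> c i /A2 cA iN; rewrite /grid dE -addrA -mulrDr -natrD; apply: gP => //.
    by rewrite addnC leq_add2r.
  + by move=> c c' /A2 cA /A2 cA' cc'; apply: gap => //; exact: lt_trans sw.
- by rewrite /d; lra.
Qed.
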